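(* Let $G:\mathbb{R}^n\to\mathbb{R}^d$ be continuously differentiable, let $D\subset\mathbb{R}^d$ be polyhedral, and let $\Gamma=\{x\in\mathbb{R}^n\mid G(x)\in D\}$. Let $\bar x\in\Gamma$ and $u\in\mathbb{R}^n$, and assume that the directional nondegeneracy condition $$\nabla G(\bar x)^Ty^*=0,\ y^*\in{\rm span}\,N_D(G(\bar x);\nabla G(\bar x)u)\ \Longrightarrow\ y^*=0$$ is fulfilled. Then $$N_\Gamma(\bar x;u)=\nabla G(\bar x)^TN_D(G(\bar x);\nabla G(\bar x)u)=\nabla G(\bar x)^TN_{T_D(G(\bar x))}(\nabla G(\bar x)u)=N_{T_\Gamma(\bar x)}(u).$$
   Context: A set $D\subset\mathbb{R}^d$ is convex polyhedral if it is the intersection of finitely many halfspaces, and polyhedral if it is the union of finitely many convex polyhedral sets (so $D$ need not be convex). For a set $S$ and $z\in S$: Tangent cone: $T_S(z)=\{w\mid\exists t_k\downarrow0,\ w_k\to w:\ z+t_kw_k\in S\}$. Regular (Fréchet) normal cone: $\widehat N_S(z)=\{z^*\mid\langle z^*,z'-z\rangle\le o(\|z'-z\|)\ \forall z'\in S\}$, which equals the polar cone of $T_S(z)$. Limiting normal cone: $N_S(z)=\{z^*\mid\exists z_k\to z,\ z_k\in S,\ z^*_k\to z^*,\ z^*_k\in\widehat N_S(z_k)\}$. Directional limiting normal cone at $z$ in direction $w$: $N_S(z;w)=\{z^*\mid\exists t_k\downarrow0,\ w_k\to w,\ z^*_k\to z^*:\ z+t_kw_k\in S,\ z^*_k\in\widehat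 N_S(z+t_kw_k)\}$. Convention: tangent and normal cones to $S$ at points outside $S$ are empty; the linear span of the empty set is $\{0\}$. For a matrix $A$ and a set $M$, $A M=\{Ay\mid y\in M\}$. *)

(* Defs.v *)
(* Vectors of R^n are row vectors ('rV[R]_n). *)
From mathcomp Require Export all_boot all_order all_algebra.
From mathcomp Require Export all_classical all_reals all_analysis.
Export numFieldNormedType.Exports.

Set Implicit Arguments.
Unset Strict Implicit.
Unset Printing Implicit Defensive.

Import Order.TTheory GRing.Theory Num.Theory.

Local Open Scope classical_set_scope.
Local Open Scope ring_scope.

Definition inner (R : realType) (n : nat) (x y : 'rV[R]_n) : R :=
  \sum_(i < n) x ord0 i * y ord0 i.

Definition halfspace (R : realType) (n : nat) (H : set 'rV[R]_n) : Prop :=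
  exists a : 'rV[R]_n, exists b : R, a != 0 /\ H = [set z | inner a z <= b].

Definition convex_polyhedral (R : realType) (n : nat) (C : set 'rV[R]_n) : Prop :=
  exists (m : nat) (H : 'I_m -> set 'rV[R]_n),
    (forall i, halfspace (H i)) /\ C = \bigcap_i H i.

Definition polyhedral (R : realType) (n : nat) (D : set 'rV[R]_n) : Prop :=
  exists (m : nat) (C : 'I_m -> set 'rV[R]_n),
    (forall i, convex_polyhedral (C i)) /\ D = \bigcup_i C i.

(* t_k \downarrow 0: positive reals tending to 0; monotonicity is not required. *)
Definition downto0 (R : realType) (t : nat -> R) : Prop :=
  (forall k, 0 < t k) /\ t @ \oo --> 0.

(* The conjunct S z in the cones below makes them empty at points outside S. *)
Definition tangent_cone (R : realType) (n : nat) (S : set 'rV[R]_n)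
    (z : 'rV[R]_n) : set 'rV[R]_n :=
  [set w | S z /\
    exists (t : nat -> R) (w_ : nat -> 'rV[R]_n),
      [/\ downto0 t, w_ @ \oo --> w & forall k, S (z + t k *: w_ k)]].

(* The norm on 'rV[R]_n is the sup norm; as all norms on R^n are equivalent,
   the o(|z' - z|) condition is the same as for the Euclidean norm. *)
Definition regular_normal_cone (R : realType) (n : nat) (S : set 'rV[R]_n)
    (z : 'rV[R]_n) : set 'rV[R]_n :=
  [set zs | S z /\
    forall e : R, 0 < e ->
      \forall z' \near z, S z' -> inner zs (z' - z) <= e * `|z' - z|].

Definition limiting_normal_cone (R : realType) (n : nat) (S : set 'rV[R]_n)
    (z : 'rV[R]_n) : set 'rV[R]_n :=
  [set zs | S z /\
    exists (z_ zs_ : nat -> 'rV[R]_n),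
      [/\ z_ @ \oo --> z, forall k, S (z_ k), zs_ @ \oo --> zs
        & forall k, regular_normal_cone S (z_ k) (zs_ k)]].

Definition dir_normal_cone (R : realType) (n : nat) (S : set 'rV[R]_n)
    (z w : 'rV[R]_n) : set 'rV[R]_n :=
  [set zs | S z /\
    exists (t : nat -> R) (w_ zs_ : nat -> 'rV[R]_n),
      [/\ downto0 t, w_ @ \oo --> w, zs_ @ \oo --> zs,
          forall k, S (z + t k *: w_ k)
        & forall k, regular_normal_cone S (z + t k *: w_ k) (zs_ k)]].

Definition linear_span (R : realType) (n : nat) (M : set 'rV[R]_n) : set 'rV[R]_n :=
  [set y | exists s : seq 'rV[R]_n,
    (forall x, x \in s -> M x) /\ y \in span s].

Definition continuously_differentiable (R : realType) (n d : nat)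
    (G : 'rV[R]_n -> 'rV[R]_d) : Prop :=
  (forall x, differentiable G x) /\ continuous (jacobian G).

(* 'J G x acts on row vectors from the right (dG(x) v = v *m 'J G x), so it is
   the transpose of the usual d x n Jacobian matrix. Hence the usual
   (nabla G(x)) u is jac_mul G x u, and (nabla G(x))^T y is jacT_mul G x y. *)
Definition jac_mul (R : realType) (n d : nat) (G : 'rV[R]_n -> 'rV[R]_d)
    (x u : 'rV[R]_n) : 'rV[R]_d := u *m 'J G x.

Definition jacT_mul (R : realType) (n d : nat) (G : 'rV[R]_n -> 'rV[R]_d)
    (x : 'rV[R]_n) (y : 'rV[R]_d) : 'rV[R]_n := y *m ('J G x)^T.

(* Main.v *)
(* Near [G xbar] the set [D] agrees with a translate of the cone
   [K = T_D(G xbar)], and near [w = jac_mul G xbar u] the cone [K] agrees with a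
   translate of a cone [L]; hence [N_D(G xbar; w) = N_K(w)], and every regular
   normal of [L] lies in this set. If [p] is orthogonal to it, projecting [p] on
   the tangent cones of [L] shows that [L + p] is contained in [L]. So, in
   directions close to [w], membership of [z] in [D] depends only on [z *m B^T],
   where the rows of [B] are a basis of the span of [N_D(G xbar; w)]. Directional
   nondegeneracy says exactly that [x |-> G x *m B^T] has a surjective derivative
   at [xbar], so near [xbar] and in directions close to [u] the constraint is the
   preimage of a set under a submersion: the chain rule for regular normals is
   then exact, and passing to the limit gives the first equality. The last one
   is the first applied to the linear map [jac_mul G xbar] and to [K], since
   [T_Gamma(xbar)] agrees near [u] with the preimage of [K]. *)
From HB Require Import structures.
Require Import Defs.
From mathcomp Require Import all_boot all_order all_algebra.
From mathcomp Require Import all_classical all_reals all_analysis.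
From mathcomp Require Import ring lra.

Set Implicit Arguments.
Unset Strict Implicit.
Unset Printing Implicit Defensive.

Import Order.TTheory GRing.Theory Num.Theory.

Local Open Scope classical_set_scope.
Local Open Scope ring_scope.

(** * Sup-norm estimates and the bilinear form [inner] *)

Section Norms.
Variable R : realType.

Lemma mx_norm_le m n (A : 'M[R]_(m, n)) (b : R) :
  0 <= b -> (forall i j, `|A i j| <= b) -> `|A| <= b.
Proof.
move=> b0 Ab; rewrite /Num.norm/= mx_normrE.
by apply/bigmax_leP; split => // -[i j] _; exact: Ab.
Qed.

Lemma le_mx_norm m n (A : 'M[R]_(m, n)) i j : `|A i j| <= `|A|.
Proof.
rewrite {2}/Num.norm/= mx_normrE.
exact: (@le_bigmax _ _ _ 0 (fun ij : 'I_m * 'I_n => `|A ij.1 ij.2|) (i, j)).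
Qed.

Lemma norm_mulmx m n p (A : 'M[R]_(m, n)) (B : 'M[R]_(n, p)) :
  `|A *m B| <= n%:R * `|A| * `|B|.
Proof.
apply: mx_norm_le => [|i j]; first by rewrite !mulr_ge0.
rewrite mxE (le_trans (ler_norm_sum _ _ _))//.
have -> : n%:R * `|A| * `|B| = \sum_(k < n) `|A| * `|B|.
  by rewrite sumr_const card_ord -mulrA mulr_natl.
by apply: ler_sum => k _; rewrite normrM ler_pM ?le_mx_norm.
Qed.

Lemma norm_trmx m n (A : 'M[R]_(m, n)) : `|A^T| = `|A|.
Proof.
by apply/eqP; rewrite eq_le; apply/andP; split; apply: mx_norm_le => // i j;
  by [rewrite mxE le_mx_norm | have := le_mx_norm A^T j i; rewrite mxE].
Qed.

Lemma near_normP n (z : 'rV[R]_n) (P : 'rV[R]_n -> Prop) :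
  (\forall z' \near z, P z') <->
  (exists2 r : R, 0 < r & forall z', `|z' - z| < r -> P z').
Proof.
split=> [/nbhs_normP[r /= r0 zP]|[r r0 zP]].
  by exists r => // z' z'z; apply: zP => /=; rewrite distrC.
by apply/nbhs_normP; exists r => // z' /=; rewrite distrC => /zP.
Qed.

Lemma cvg_normP n (z_ : nat -> 'rV[R]_n) (z : 'rV[R]_n) :
  z_ @ \oo --> z <-> (forall e : R, 0 < e -> \forall k \near \oo, `|z_ k - z| < e).
Proof.
split=> [/cvgrPdist_lt H e e0|H].
  by apply: filterS (H e e0) => k; rewrite distrC.
by apply/cvgrPdist_lt => e /H; apply: filterS => k; rewrite distrC.
Qed.

Lemma innerE n (x y : 'rV[R]_n) : inner x y = (x *m y^T) ord0 ord0.
Proof. by rewrite mxE; apply: eq_bigr => i _; rewrite mxE. Qed.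

Lemma innerC n (x y : 'rV[R]_n) : inner x y = inner y x.
Proof. by apply: eq_bigr => i _; rewrite mulrC. Qed.

Lemma innerDr n (x y z : 'rV[R]_n) : inner x (y + z) = inner x y + inner x z.
Proof. by rewrite !innerE linearD mulmxDr mxE. Qed.

Lemma innerZr n (x y : 'rV[R]_n) a : inner x (a *: y) = a * inner x y.
Proof. by rewrite !innerE linearZ/= -scalemxAr mxE. Qed.

Lemma innerNr n (x y : 'rV[R]_n) : inner x (- y) = - inner x y.
Proof. by rewrite -scaleN1r innerZr mulN1r. Qed.

Lemma innerBr n (x y z : 'rV[R]_n) : inner x (y - z) = inner x y - inner x z.
Proof. by rewrite innerDr innerNr. Qed.

Lemma innerBl n (x y z : 'rV[R]_n) : inner (x - y) z = inner x z - inner y z.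
Proof. by rewrite innerC innerBr !(innerC z). Qed.

Lemma inner_norm n (x y : 'rV[R]_n) : `|inner x y| <= n%:R * `|x| * `|y|.
Proof.
by rewrite innerE (le_trans (le_mx_norm _ _ _))// (le_trans (norm_mulmx _ _))// norm_trmx.
Qed.

Lemma inner_eq0 n (x : 'rV[R]_n) : inner x x = 0 -> x = 0.
Proof.
move=> xx; apply/rowP => i; rewrite mxE; apply/eqP.
have /psumr_eq0P/(_ xx) : forall i : 'I_n, true -> 0 <= x ord0 i * x ord0 i.
  by move=> j _; rewrite -expr2 sqr_ge0.
by move=> /(_ i isT)/eqP; rewrite mulf_eq0 orbb.
Qed.

Lemma inner_adjoint m n (y : 'rV[R]_m) (v : 'rV[R]_n) (J : 'M[R]_(n, m)) :
  inner (y *m J^T) v = inner y (v *m J).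
Proof. by rewrite !innerE trmx_mul mulmxA. Qed.

End Norms.

(* Completes the inheritance of ['rV[R]_n] to [completeNormedModType]. *)
HB.instance Definition _ (R : realType) n :=
  Uniform_isComplete.Build 'rV[R]_n
    (@cauchy_cvg (matrix R 1 n : completeType)).

Lemma contraction_fixpoint (R : realType) n (f : 'rV[R]_n -> 'rV[R]_n) (r q : R) :
  0 <= r -> 0 <= q < 1 ->
  (forall x, `|x| <= r -> `|f x| <= r) ->
  (forall x y, `|x| <= r -> `|y| <= r -> `|f x - f y| <= q * `|x - y|) ->
  exists2 p, `|p| <= r & f p = p.
Proof.
move=> r0 /andP[q0 q1] fr fq; pose U := [set x : 'rV[R]_n | `|x| <= r].
have fU : set_fun U U f by move=> x; exact: fr.
pose g : {fun U >-> U} := mkfun fU.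
have ctr : is_contraction g.
  exists (NngNum q0); split=> //= -[x y] [] /= xU yU.
  exact: fq.
have cU : closed U.
  have -> : U = closed_ball_ (fun x => `|x|) 0 r.
    by apply/seteqP; split=> x; rewrite /U /closed_ball_ /= sub0r normrN.
  exact: closed_closed_ball_.
have U0 : U !=set0 by exists 0; rewrite /U/= normr0.
by have [p Up gp] := banach_fixed_point ctr cU U0; exists p.
Qed.

(** * Epsilon forms of the tangent and normal cones *)

Section SequenceFree.
Variable R : realType.

Lemma near_inv_succ (e : R) : 0 < e -> \forall k \near \oo, k.+1%:R^-1 < e.
Proof.
move=> e0; apply: filterS (near_infty_natSinv_lt (PosNum e0)) => k.
exact.
Qed.

Lemma cvg_inv_succ n (z_ : nat -> 'rV[R]_n) z :
  (forall k, `|z_ k - z| < k.+1%:R^-1) -> z_ @ \oo --> z.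
Proof.
move=> H; apply/cvg_normP => e /near_inv_succ; apply: filterS => k.
exact: lt_trans (H k).
Qed.

Lemma downto0_inv_succ (t : nat -> R) :
  (forall k, 0 < t k < k.+1%:R^-1) -> downto0 t.
Proof.
move=> H; split=> [k|]; first by have /andP[] := H k.
apply/cvgrPdist_lt => e /near_inv_succ; apply: filterS => k ke.
have /andP[tk0 tk] := H k.
by rewrite sub0r normrN gtr0_norm// (lt_trans tk).
Qed.

Lemma downto0_near (t : nat -> R) (e : R) : downto0 t -> 0 < e ->
  \forall k \near \oo, 0 < t k < e.
Proof.
move=> [t0 /cvgrPdist_lt t_cvg] /t_cvg; apply: filterS => k.
by rewrite sub0r normrN gtr0_norm// t0.
Qed.

(** Choosing witnesses for [e = 1 / (k + 1)] recovers the sequences. The epsilon form, here and for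
    the two normal cones below, lets later arguments treat one approximating point at a time. *)
Lemma tangent_coneP n (S : set 'rV[R]_n) z w : tangent_cone S z w <->
  S z /\ forall e, 0 < e -> exists t w',
    [/\ 0 < t < e, `|w' - w| < e & S (z + t *: w')].
Proof.
split=> -[Sz].
  move=> [t [w_ [t0 /cvg_normP wcvg Sk]]]; split=> // e e0.
  have [k [tk wk]] := filter_ex (filterI (downto0_near t0 e0) (wcvg e e0)).
  by exists (t k), (w_ k).
move=> H; split=> //.
have /choice[p Hp] : forall k : nat, exists p : R * 'rV[R]_n,
    [/\ 0 < p.1 < k.+1%:R^-1, `|p.2 - w| < k.+1%:R^-1 & S (z + p.1 *: p.2)].
  by move=> k; have [//|t [w' ?]] := H k.+1%:R^-1; exists (t, w').
exists (fun k => (p k).1), (fun k => (p k).2); split.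
- by apply: downto0_inv_succ => k; have [] := Hp k.
- by apply: cvg_inv_succ => k; have [] := Hp k.
- by move=> k; have [] := Hp k.
Qed.

Lemma dir_normal_coneP n (S : set 'rV[R]_n) z w zs : dir_normal_cone S z w zs <->
  S z /\ forall e, 0 < e -> exists t w' zs',
    [/\ 0 < t < e, `|w' - w| < e, `|zs' - zs| < e &
        regular_normal_cone S (z + t *: w') zs'].
Proof.
split=> -[Sz].
  move=> [t [w_ [zs_ [t0 /cvg_normP wcvg /cvg_normP zscvg Sk Nk]]]]; split=> // e e0.
  have [k [[tk wk] zsk]] :=
    filter_ex (filterI (filterI (downto0_near t0 e0) (wcvg e e0)) (zscvg e e0)).
  by exists (t k), (w_ k), (zs_ k).
move=> H; split=> //.
have /choice[p Hp] : forall k : nat, exists p : R * 'rV[R]_n * 'rV[R]_n,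
    [/\ 0 < p.1.1 < k.+1%:R^-1, `|p.1.2 - w| < k.+1%:R^-1,
        `|p.2 - zs| < k.+1%:R^-1 &
        regular_normal_cone S (z + p.1.1 *: p.1.2) p.2].
  by move=> k; have [//|t [w' [zs' ?]]] := H k.+1%:R^-1; exists (t, w', zs').
exists (fun k => (p k).1.1), (fun k => (p k).1.2), (fun k => (p k).2); split.
- by apply: downto0_inv_succ => k; have [] := Hp k.
- by apply: cvg_inv_succ => k; have [] := Hp k.
- by apply: cvg_inv_succ => k; have [] := Hp k.
- by move=> k; have [_ _ _ []] := Hp k.
- by move=> k; have [] := Hp k.
Qed.

Lemma limiting_normal_coneP n (S : set 'rV[R]_n) z zs :
  limiting_normal_cone S z zs <->
  S z /\ forall e, 0 < e -> exists z' zs',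
    [/\ `|z' - z| < e, `|zs' - zs| < e & regular_normal_cone S z' zs'].
Proof.
split=> -[Sz].
  move=> [z_ [zs_ [/cvg_normP zcvg Sk /cvg_normP zscvg Nk]]]; split=> // e e0.
  have [k [zk zsk]] := filter_ex (filterI (zcvg e e0) (zscvg e e0)).
  by exists (z_ k), (zs_ k).
move=> H; split=> //.
have /choice[p Hp] : forall k : nat, exists p : 'rV[R]_n * 'rV[R]_n,
    [/\ `|p.1 - z| < k.+1%:R^-1, `|p.2 - zs| < k.+1%:R^-1 &
        regular_normal_cone S p.1 p.2].
  by move=> k; have [//|z' [zs' ?]] := H k.+1%:R^-1; exists (z', zs').
exists (fun k => (p k).1), (fun k => (p k).2); split.
- by apply: cvg_inv_succ => k; have [] := Hp k.
- by move=> k; have [_ _ []] := Hp k.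
- by apply: cvg_inv_succ => k; have [] := Hp k.
- by move=> k; have [] := Hp k.
Qed.

Lemma regular_normal_coneP n (S : set 'rV[R]_n) z zs :
  regular_normal_cone S z zs <->
  S z /\ forall e, 0 < e -> exists2 r, 0 < r &
    forall h, `|h| < r -> S (z + h) -> inner zs h <= e * `|h|.
Proof.
split=> -[Sz H]; split=> // e e0.
  have /near_normP[r r0 Hr] := H e e0; exists r => // h hr Szh.
  by have := Hr (z + h); rewrite addrAC subrr add0r; apply.
have [r r0 Hr] := H e e0; apply/near_normP; exists r => // z' z'z Sz'.
by apply: Hr => //; rewrite addrC subrK.
Qed.

End SequenceFree.

(** * Local conical structure of polyhedral sets *)

Section PolyhedralGerms.
Variable R : realType.

(* Unlike in [halfspace], [a] may be zero, so that the whole space and the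
   empty set are included. *)
Inductive polyset n : set 'rV[R]_n -> Prop :=
| polyset_half a b : polyset [set z | inner a z <= b]
| polysetI S T : polyset S -> polyset T -> polyset (S `&` T)
| polysetU S T : polyset S -> polyset T -> polyset (S `|` T).

Lemma polysetT n : polyset [set: 'rV[R]_n].
Proof.
have := polyset_half (0 : 'rV[R]_n) 0; congr polyset.
by apply/seteqP; split=> // z _; rewrite /= innerE mul0mx mxE.
Qed.

Lemma polyset0 n : polyset (@set0 'rV[R]_n).
Proof.
have := polyset_half (0 : 'rV[R]_n) (-1); congr polyset.
by apply/seteqP; split=> // z; rewrite /= innerE mul0mx mxE oppr_ge0 ler10.
Qed.

Lemma polyhedral_polyset n (D : set 'rV[R]_n) : polyhedral D -> polyset D.
Proof.
have ordT m : [set: 'I_m] = [set` enum 'I_m].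
  by apply/seteqP; split=> // i _; rewrite /= mem_enum.
move=> [m [C [polyC ->]]]; rewrite ordT bigcup_seq.
apply: big_ind => [||i _]; [exact: polyset0|exact: polysetU|].
have [p [H [halfH ->]]] := polyC i; rewrite ordT bigcap_seq.
apply: big_ind => [||j _]; [exact: polysetT|exact: polysetI|].
by have [a [b [_ ->]]] := halfH j; exact: polyset_half.
Qed.

Lemma closed_near n (S : set 'rV[R]_n) w : closed S ->
  (forall e, 0 < e -> exists2 w', `|w' - w| < e & S w') -> S w.
Proof.
move=> cS H; apply: cS => A /near_normP[r r0 rA].
by have [w' /rA Aw' Sw'] := H r r0; exists w'.
Qed.

Lemma halfspace_germ n (a : 'rV[R]_n) b z : inner a z != b ->
  exists2 r : R, 0 < r & forall h, `|h| < r ->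
    (inner a (z + h) <= b) = (inner a z <= b).
Proof.
(* On this ball [inner_norm] keeps [|inner a h|] below the gap [|b - inner a z|]. *)
move=> az; exists (`|b - inner a z| / (n%:R * `|a| + 1)) => [|h].
  by rewrite divr_gt0 ?normr_gt0 ?subr_eq0 1?eq_sym// ltr_wpDl// mulr_ge0.
rewrite ltr_pdivlMr ?ltr_wpDl// ?mulr_ge0// => hr.
have : `|inner a h| < `|b - inner a z|.
  rewrite (le_lt_trans (inner_norm _ _))// (le_lt_trans _ hr)//.
  by rewrite mulrC ler_wpM2l// lerDl.
rewrite innerDr ltr_norml => /andP[].
case: (ltgtP (inner a z) b) az => // ab _.
- by rewrite gtr0_norm ?subr_gt0// => *; apply/idP; lra.
- rewrite ltr0_norm ?subr_lt0// => *; apply/negbTE; rewrite -ltNge; lra.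
Qed.

Lemma polyset_closed n (S : set 'rV[R]_n) : polyset S -> closed S.
Proof.
elim=> [a b|A B _ cA _ cB|A B _ cA _ cB]; [|exact: closedI|exact: closedU].
rewrite -openC openE => z /= zb; apply/near_normP.
have [|r r0 rH] := @halfspace_germ n a b z.
  by apply: contra_notN zb => /eqP ->.
by exists r => // z' /rH; rewrite addrC subrK /= => ->.
Qed.

Definition same_germ n (S : set 'rV[R]_n) z (S' : set 'rV[R]_n) z' :=
  exists2 r : R, 0 < r & forall h, `|h| < r -> (S (z + h) <-> S' (z' + h)).

(** Only positive factors occur, so the empty set is a cone: it is the germ at a point outside a
    closed set. *)
Definition conic n (K : set 'rV[R]_n) := forall t w, 0 < t -> K w -> K (t *: w).

Lemma same_germ_sym n (S S' : set 'rV[R]_n) z z' :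
  same_germ S z S' z' -> same_germ S' z' S z.
Proof. by move=> [r r0 H]; exists r => // h /H[]. Qed.

(** By induction: an inequality active at [z] becomes homogeneous, a strict one becomes the whole
    space, a violated one the empty set; for unions and intersections the smaller radius is kept. *)
Lemma polyset_germ n (S : set 'rV[R]_n) z : polyset S ->
  exists K, [/\ polyset K, conic K & same_germ S z K 0].
Proof.
elim=> [a b|A B _ [K [pK cK [r r0 H]]] _ [K' [pK' cK' [r' r'0 H']]]
       |A B _ [K [pK cK [r r0 H]]] _ [K' [pK' cK' [r' r'0 H']]]].
- have [ab|/halfspace_germ[r r0 H]] := eqVneq (inner a z) b.
    exists [set z | inner a z <= 0]; split; first exact: polyset_half.
      by move=> t w t0; rewrite /= innerZr pmulr_rle0.
    by exists 1 => // h _; rewrite /= innerDr ab gerDl add0r.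
  have [zb|zb] := boolP (inner a z <= b).
    exists setT; split => //; first exact: polysetT.
    by exists r => // h /H /= ->; rewrite zb.
  exists set0; split => //; first exact: polyset0.
  by exists r => // h /H /= ->; rewrite (negbTE zb).
- exists (K `&` K'); split; first exact: polysetI.
    by move=> t w t0 [? ?]; split; [exact: cK|exact: cK'].
  exists (Num.min r r'); first by rewrite lt_min r0.
  by move=> h; rewrite lt_min => /andP[/H[h1 h2] /H'[h3 h4]]; split=> -[]; split; auto.
- exists (K `|` K'); split; first exact: polysetU.
    by move=> t w t0 [?|?]; [left; exact: cK|right; exact: cK'].
  exists (Num.min r r'); first by rewrite lt_min r0.
  by move=> h; rewrite lt_min => /andP[/H[h1 h2] /H'[h3 h4]];
    split=> -[]; [left|right|left|right]; auto.
Qed.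

Lemma regular_normal_germ n (S S' : set 'rV[R]_n) z z' : same_germ S z S' z' ->
  regular_normal_cone S z `<=` regular_normal_cone S' z'.
Proof.
move=> [r r0 H] zs /regular_normal_coneP[Sz Hzs]; apply/regular_normal_coneP; split.
  by have [] := H 0; rewrite ?normr0// !addr0; auto.
move=> e /Hzs[r' r'0 H']; exists (Num.min r r'); first by rewrite lt_min r0.
by move=> h; rewrite lt_min => /andP[/H[_ h1] /H' h2] /h1.
Qed.

Lemma regular_normal_conic n (K : set 'rV[R]_n) w t : conic K -> 0 < t ->
  regular_normal_cone K w `<=` regular_normal_cone K (t *: w).
Proof.
move=> cK t0 zs /regular_normal_coneP[Kw Hw]; apply/regular_normal_coneP.
split=> [|e /Hw[r r0 H]]; first exact: cK.
exists (t * r); first exact: mulr_gt0.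
move=> h hr Kh; have := H (t^-1 *: h).
rewrite innerZr normrZ gtr0_norm ?invr_gt0// ltr_pdivrMl// mulrCA.
rewrite ler_pM2l ?invr_gt0//; apply=> //.
have -> : w + t^-1 *: h = t^-1 *: (t *: w + h).
  by rewrite scalerDr scalerA mulVf ?gt_eqF// scale1r.
by apply: cK; rewrite ?invr_gt0.
Qed.

Lemma regular_normal_conicE n (K : set 'rV[R]_n) w t : conic K -> 0 < t ->
  regular_normal_cone K (t *: w) = regular_normal_cone K w.
Proof.
move=> cK t0; apply/seteqP; split; last exact: regular_normal_conic.
have := @regular_normal_conic _ K (t *: w) t^-1 cK.
by rewrite scalerA mulVf ?gt_eqF// scale1r invr_gt0; apply.
Qed.

Lemma conic0 n (K : set 'rV[R]_n) w : closed K -> conic K -> K w -> K 0.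
Proof.
move=> clK cK Kw; apply: closed_near => // e e0.
exists ((e / (`|w| + 1)) *: w).
  rewrite subr0 normrZ gtr0_norm ?divr_gt0 ?ltr_wpDl// mulrAC ltr_pdivrMr ?ltr_wpDl//.
  by rewrite ltr_pM2l// ltrDl.
by apply: cK => //; rewrite divr_gt0 ?ltr_wpDl.
Qed.

Lemma same_germ_scale n (S K : set 'rV[R]_n) z : same_germ S z K 0 ->
  forall b : R, exists2 e, 0 < e & forall t w,
    0 < t < e -> `|w| < b -> same_germ S (z + t *: w) K (t *: w).
Proof.
move=> [r r0 H] b; exists (r / (`|b| + 1)).
  by rewrite divr_gt0// ltr_wpDl.
move=> t w /andP[t0]; rewrite ltr_pdivlMr ?ltr_wpDl// => tr wb.
have twr : `|t *: w| < r.
  rewrite normrZ gtr0_norm// (le_lt_trans _ tr)// ler_pM2l//.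
  by rewrite (le_trans (ltW wb))// (le_trans (ler_norm b))// lerDl.
exists (r - `|t *: w|); first by rewrite subr_gt0.
move=> h hr; have := H (t *: w + h); rewrite add0r addrA; apply.
by rewrite (le_lt_trans (ler_normD _ _))// -ltrBrDl.
Qed.

(** Scaling invariance of [K] removes [t]: near [z], membership in [S] and regular normals depend on
    the direction [w] only, uniformly for bounded [w]. *)
Lemma same_germ_conic n (S K : set 'rV[R]_n) z : conic K -> same_germ S z K 0 ->
  forall b : R, exists2 e, 0 < e & forall t w,
    0 < t < e -> `|w| < b -> (S (z + t *: w) <-> K w) /\
      regular_normal_cone S (z + t *: w) = regular_normal_cone K w.
Proof.
move=> cK /same_germ_scale H b; have [e e0 {}H] := H b; exists e => // t w te wb.
have tg := H t w te wb; have /andP[t0 _] := te; split.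
  have [r r0 /(_ 0)] := tg; rewrite normr0 !addr0 => /(_ r0) ->.
  split; last exact: cK.
  move=> /(cK t^-1); rewrite scalerA mulVf ?gt_eqF// scale1r.
  by apply; rewrite invr_gt0.
rewrite -(@regular_normal_conicE _ K w t)//; apply/seteqP; split.
  exact: regular_normal_germ.
by apply: regular_normal_germ; exact: same_germ_sym.
Qed.

Lemma lt_norm_near n (w w' : 'rV[R]_n) : `|w' - w| < 1 -> `|w'| < `|w| + 1.
Proof.
by move=> ww'; rewrite -[w'](subrK w) (le_lt_trans (ler_normD _ _))// addrC ltrD2l.
Qed.

Lemma tangent_cone_germ n (S K : set 'rV[R]_n) z :
  closed K -> conic K -> same_germ S z K 0 -> S z -> tangent_cone S z = K.
Proof.
move=> clK cK SK Sz; apply/seteqP; split=> w.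
  move=> /tangent_coneP[_ H]; apply: closed_near => // e e0.
  have [d d0 Hd] := same_germ_conic cK SK (`|w| + 1).
  have [|t [w' []]] := H (Num.min (Num.min d e) 1); first by rewrite !lt_min d0 e0 ltr01.
  rewrite !lt_min => /andP[t0 /andP[/andP[td _] _]] /andP[/andP[_ we] w1] Sw'.
  exists w' => //; have [|[/(_ Sw') //]] := Hd t w' _ (lt_norm_near w1).
  by rewrite t0.
move=> Kw; apply/tangent_coneP; split=> // e e0.
have [d d0 Hd] := same_germ_conic cK SK (`|w| + 1).
exists (Num.min d e / 2), w; rewrite subrr normr0; split=> //.
  rewrite divr_gt0 ?lt_min ?d0//= ltr_pdivrMr// gt_min; apply/orP; right; lra.
have [||[_ /(_ Kw)//]] := Hd (Num.min d e / 2) w; last by rewrite ltrDl.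
rewrite divr_gt0 ?lt_min ?d0//= ltr_pdivrMr// gt_min; apply/orP; left; lra.
Qed.

(** A regular normal of [S] at [z + t *: w'] is one of [K] at [w'], so the step length drops out of
    the definition; conversely every small enough [t] will do. *)
Lemma dir_normal_germ n (S K : set 'rV[R]_n) z w :
  closed K -> conic K -> same_germ S z K 0 -> S z ->
  dir_normal_cone S z w = limiting_normal_cone K w.
Proof.
move=> clK cK SK Sz; have [d d0 Hd] := same_germ_conic cK SK (`|w| + 1).
apply/seteqP; split=> zs.
  move=> /dir_normal_coneP[_ H].
  (* This also yields [K w], by closedness, as [w] is a limit of points of [K]. *)
  suff H' e : 0 < e -> exists z' zs', [/\ `|z' - w| < e, `|zs' - zs| < e &
      regular_normal_cone K z' zs'].
    apply/limiting_normal_coneP; split=> //; apply: closed_near => // e.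
    by move=> /H'[w' [_ [we _ [Kw' _]]]]; exists w'.
  move=> e0.
  have [|t [w' [zs' []]]] := H (Num.min (Num.min d e) 1); first by rewrite !lt_min d0 e0 ltr01.
  rewrite !lt_min => /andP[t0 /andP[/andP[td _] _]] /andP[/andP[_ we] w1].
  move=> /andP[/andP[_ zse] _]; have [|_ ->] := Hd t w' _ (lt_norm_near w1).
    by rewrite t0.
  by exists w', zs'.
move=> /limiting_normal_coneP[Kw H]; apply/dir_normal_coneP; split=> // e e0.
have [|w' [zs' []]] := H (Num.min e 1); first by rewrite lt_min e0 ltr01.
rewrite !lt_min => /andP[we w1] /andP[zse _] N.
have t0 : 0 < Num.min d e / 2 by rewrite divr_gt0 ?lt_min ?d0.
exists (Num.min d e / 2), w', zs'; split=> //.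
  rewrite t0/= ltr_pdivrMr// gt_min; apply/orP; right; lra.
have [|_ ->//] := Hd (Num.min d e / 2) w' _ (lt_norm_near w1).
rewrite t0/= ltr_pdivrMr// gt_min; apply/orP; left; lra.
Qed.

Lemma same_germ_refl n (S : set 'rV[R]_n) z : same_germ S z S z.
Proof. by exists 1. Qed.

End PolyhedralGerms.

(** * Projections, normals and translation invariance *)

Section Invariance.
Variable R : realType.

(** Compares the sup norm with the Euclidean one: projections minimise [inner], while neighbourhoods
    use the sup norm. *)
Lemma sqr_norm_le_inner n (x : 'rV[R]_n) : `|x| ^+ 2 <= inner x x.
Proof.
have x_ge0 : 0 <= inner x x by apply: sumr_ge0 => i _; rewrite -expr2 sqr_ge0.
rewrite -(sqr_sqrtr x_ge0) ler_sqr ?nnegrE ?sqrtr_ge0//.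
apply: mx_norm_le; first exact: sqrtr_ge0.
move=> i j; rewrite (ord1 i) -sqrtr_sqr ler_sqrt//.
rewrite /inner (bigD1 j)//= -expr2 lerDl.
by apply: sumr_ge0 => k _; rewrite -expr2 sqr_ge0.
Qed.

(** The points of [M] at least as close to [p] as [q0] form a compact set, and a minimiser over it
    is one over [M]. *)
Lemma nearest_point n (M : set 'rV[R]_n) (p : 'rV[R]_n) : closed M -> M !=set0 ->
  exists2 q, M q & forall q', M q' -> inner (p - q) (p - q) <= inner (p - q') (p - q').
Proof.
move=> cM [q0 Mq0]; pose f q := inner (p - q) (p - q).
have cf : continuous f.
  apply: (continuous_big (op := +%R)) => [|i _ q]; first exact: add_continuous.
  have ci : {for q, continuous (fun q : 'rV[R]_n => (p - q) ord0 i)}.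
    apply: (@continuous_comp _ _ _ (fun q : 'rV_n => p - q) (fun M => M ord0 i)).
      by apply: continuousB; [exact: cst_continuous|move=> ?; exact].
    exact: coord_continuous.
  exact: (cvgM ci ci).
pose A := M `&` f @^-1` [set x | x <= f q0].
have cA : compact A.
  apply: bounded_closed_compact.
    exists (`|p| + (f q0 + 1)); split; first exact: num_real.
    move=> b bb q [_ /= fq]; rewrite (le_trans _ (ltW bb))//.
    have -> : q = p - (p - q) by rewrite opprB addrC subrK.
    rewrite (le_trans (ler_normB _ _))// lerD2l.
    have := sqr_norm_le_inner (p - q); have := normr_ge0 (p - q).
    rewrite -/(f q); nra.
  apply: closedI => //; apply: preimage_closed; first by move=> *; exact: cf.
  exact: closed_le.
have [||c] := @EVT_min_rV R n f A _ cA; first by exists q0; split=> /=.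
  exact: continuous_subspaceT.
rewrite inE => -[Mc fc] cmin; exists c => // q' Mq'.
have [fq'|/ltW fq'] := leP (f q') (f q0); last exact: le_trans fq'.
by apply: cmin; rewrite inE.
Qed.

(** Expanding the squared distance with [v = p - q] gives [2 * inner v h <= inner h h], which is of
    second order in [h]. *)
Lemma nearest_point_normal n (M : set 'rV[R]_n) (p q : 'rV[R]_n) : M q ->
  (forall q', M q' -> inner (p - q) (p - q) <= inner (p - q') (p - q')) ->
  regular_normal_cone M q (p - q).
Proof.
move=> Mq pq; apply/regular_normal_coneP; split=> // e e0.
exists (e / (n%:R + 1)) => [|h]; first by rewrite divr_gt0// ltr_wpDl.
rewrite ltr_pdivlMr ?ltr_wpDl// => he /pq.
rewrite opprD addrA; move: (p - q) => v.
rewrite [leRHS]innerBr !innerBl [inner h v]innerC => ineq.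
have hh := le_trans (ler_norm _) (inner_norm h h).
have hhe : n%:R * `|h| * `|h| <= e * `|h|.
  by rewrite ler_wpM2r// (le_trans _ (ltW he))// mulrC ler_wpM2l// lerDl.
have : 0 <= e * `|h| by rewrite mulr_ge0// ltW.
by lra.
Qed.

(** The ray through [q] stays in [K] on both sides of [q], so [y] is nonpositive along both [q] and
    [- q]. *)
Lemma regular_normal_conic_orth n (K : set 'rV[R]_n) (q y : 'rV[R]_n) : conic K ->
  regular_normal_cone K q y -> inner y q = 0.
Proof.
move=> cK /regular_normal_coneP[Kq H]; apply/eqP/negPn/negP => yq.
set a := inner y q in yq; have a0 : 0 < `|a| by rewrite normr_gt0.
have q0 : 0 < `|q| + 1 by rewrite ltr_wpDl.
have [|r r0 Hr] := H (`|a| / (2 * (`|q| + 1))); first by rewrite divr_gt0// mulr_gt0.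
(* [m <= 1 / 2] keeps [1 + s] positive and the other bound keeps [s *: q] within radius [r]. As [s]
   has the sign of [a], [y] grows at rate [|a|] there, more than the tolerance times [|q|]. *)
set m := Num.min (1 / 2) (r / (2 * (`|q| + 1))).
have m0 : 0 < m by rewrite lt_min !divr_gt0// mulr_gt0.
have m1 : m <= 1 / 2 by rewrite ge_min lexx.
have mr : m * (2 * (`|q| + 1)) <= r.
  by rewrite -ler_pdivlMr ?mulr_gt0// ge_min lexx orbT.
pose s := Num.sg a * m.
have sm : `|s| = m by rewrite normrM normr_sg (_ : a != 0)// mul1r gtr0_norm.
have /Hr : `|s *: q| < r.
  by rewrite normrZ sm (lt_le_trans _ mr)// ltr_pM2l//; have := normr_ge0 q; lra.
have -> : q + s *: q = (1 + s) *: q by rewrite scalerDl scale1r.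
move=> /(_ (cK _ _ _ Kq)); rewrite innerZr normrZ sm -/a.
have -> : s * a = m * `|a| by rewrite /s mulrAC -normrEsg mulrC.
have s1 : 0 < 1 + s.
  by have := ler_norm (- s); rewrite normrN sm; lra.
move=> /(_ s1); rewrite mulrCA ler_pM2l// mulrAC ler_pdivlMr ?mulr_gt0//.
by rewrite ler_pM2l//; have := normr_ge0 q; lra.
Qed.

(* If [x + s p] is the last point of [L] on the segment from [x] to [x + p], project [p]
   on the cone [M] to which [L] is congruent there: the residual is normal to
   [M], hence to [L], hence orthogonal to [p], and being orthogonal to the
   projection too, it vanishes. *)
Lemma polyset_orthogonal_invariant n (L : set 'rV[R]_n) (p : 'rV[R]_n) :
  polyset L -> (forall v y, regular_normal_cone L v y -> inner y p = 0) ->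
  forall x, L x -> L (x + p).
Proof.
move=> polyL Lp x Lx; have clL := polyset_closed polyL.
pose E := [set s : R | 0 <= s <= 1 /\ L (x + s *: p)].
have E0 : E 0 by split; rewrite ?lexx ?ler01// scale0r addr0.
have hsE : has_sup E by split; [exists 0|exists 1 => s [/andP[]]].
set s := sup E; have s0 : 0 <= s by apply: ub_le_sup => //; case: hsE.
have s1 : s <= 1 by apply: ge_sup => [|r [/andP[]]//]; exists 0.
(* The supremum is attained because [L] is closed. *)
have Ls : L (x + s *: p).
  apply: closed_near => // e e0.
  have [|r Er sr] := @sup_adherent _ E (e / (`|p| + 1)) _ hsE.
    by rewrite divr_gt0// ltr_wpDl.
  have rs : r <= s by apply: ub_le_sup => //; case: hsE.
  exists (x + r *: p); last by case: Er.
  rewrite opprD addrACA subrr add0r -scalerBl normrZ distrC ger0_norm ?subr_ge0//.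
  have : s - r < e / (`|p| + 1) by rewrite -/s in sr; lra.
  rewrite ltr_pdivlMr ?ltr_wpDl//; apply: le_lt_trans.
  by rewrite ler_wpM2l ?subr_ge0// lerDl.
have [M [polyM cM LM]] := polyset_germ (x + s *: p) polyL.
have M0 : M 0 by have [r r0 /(_ 0)] := LM; rewrite normr0 !addr0 => /(_ r0)[]; auto.
have Mp : M p.
  have [|q Mq qmin] := nearest_point p (polyset_closed polyM); first by exists 0.
  have Nq := nearest_point_normal Mq qmin.
  have [d d0 Hd] := same_germ_conic cM LM (`|q| + 1).
  (* [q] in [M] corresponds to the point of [L] at step [d / 2] in direction [q], with the same
     regular normals, so [Lp] applies to [p - q]. *)
  have [||_ NE] := Hd (d / 2) q; [by apply/andP; split; lra|by rewrite ltrDl|].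
  move: (Nq); rewrite -NE => /Lp pq0.
  have /eqP : p - q = 0.
    by apply: inner_eq0; rewrite innerBr pq0 (regular_normal_conic_orth cM Nq) subrr.
  by rewrite subr_eq0 => /eqP ->.
(* If [s < 1], [M p] allows a further step [t] along [p], contradicting the supremum. *)
have [|sl1] := leP 1 s.
  by move=> s1'; move: Ls; rewrite (_ : s = 1) ?scale1r//; apply/le_anti/andP.
have [d d0 Hd] := same_germ_conic cM LM (`|p| + 1).
pose t := Num.min (d / 2) (1 - s).
have t0 : 0 < t by rewrite lt_min divr_gt0//= subr_gt0.
have td : t <= d / 2 by rewrite ge_min lexx.
have ts : t <= 1 - s by rewrite ge_min lexx orbT.
have [||[_ /(_ Mp) Lt] _] := Hd t p; [by apply/andP; split; lra|by rewrite ltrDl|].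
have : s + t <= s.
  apply: ub_le_sup; first by case: hsE.
  by split; [apply/andP; split; lra|rewrite scalerDl addrA].
by lra.
Qed.

Lemma linear_span_add n (M : set 'rV[R]_n) (x y : 'rV[R]_n) (a : R) :
  linear_span M x -> M y -> linear_span M (x + a *: y).
Proof.
move=> [s [sM xs]] My; exists (y :: s); split.
  by move=> z; rewrite inE => /orP[/eqP ->//|/sM].
by rewrite span_cons addrC memv_add// memvZ// memv_line.
Qed.

(** Rank is maximised among the matrices whose row combinations lie in the span: some [y] in [M]
    outside the row space would raise it. *)
Lemma linear_span_basis n (M : set 'rV[R]_n) : exists r (B : 'M[R]_(r, n)),
  [/\ row_free B, forall c, linear_span M (c *m B)
    & forall y, M y -> (y <= B)%MS].
Proof.
pose good (B : 'M[R]_n) := forall c : 'rV_n, linear_span M (c *m B).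
pose P k := `[< exists2 B, good B & \rank B = k >].
have P0 : exists k, P k.
  exists 0%N; apply/asboolP; exists 0; last by rewrite mxrank0.
  by move=> c; exists [::]; split=> //; rewrite mulmx0 mem0v.
have Pn k : P k -> (k <= n)%N by move=> /asboolP[B _ <-]; exact: rank_leq_row.
have [k /asboolP[B goodB rkB] kmax] := ex_maxnP P0 Pn.
exists (\rank B), (row_base B); split; first exact: row_base_free.
  move=> c; have /submxP[c' ->] : (c *m row_base B <= B)%MS.
    by rewrite (submx_trans (submxMl _ _))// eq_row_base.
  exact: goodB.
move=> y My; rewrite eq_row_base; apply/negPn/negP => yB.
have : P (\rank (col_mx B y)).
  apply/asboolP; exists <<col_mx B y>>%MS; last by rewrite genmxE.
  move=> c; have /submxP[c' ->] : (c *m <<col_mx B y>> <= col_mx B y)%MS.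
    by rewrite (submx_trans (submxMl _ _))// genmxE.
  rewrite -[c']hsubmxK mul_row_col [rsubmx c']mx11_scalar mul_scalar_mx.
  exact: linear_span_add.
move=> /kmax; rewrite -rkB leqNgt => /negP; apply.
rewrite -addsmxE; apply: rank_ltmx; rewrite /ltmx addsmxSl/=.
by apply: contraNN yB; apply: submx_trans; exact: addsmxSr.
Qed.

(** Local saturation of [D] along the fibres of [y |-> y *m B^T], in small steps from [z] with
    directions near [w]. *)
Definition dir_invariant r n (D : set 'rV[R]_n) (z w : 'rV[R]_n) (B : 'M[R]_(r, n)) :=
  exists2 e : R, 0 < e & forall t w1 w2, 0 < t < e -> `|w1 - w| < e -> `|w2 - w| < e ->
    w1 *m B^T = w2 *m B^T -> D (z + t *: w1) -> D (z + t *: w2).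

(** The regular normals of the germ [L] of [K] at [w] lie in the row space of [B], to which
    [w2 - w1] is orthogonal; translation by it preserves [L], and the germs carry this to [K] and
    [D]. *)
Lemma polyset_dir_invariant r n (D K : set 'rV[R]_n) (z w : 'rV[R]_n) (B : 'M[R]_(r, n)) :
  polyset K -> conic K -> same_germ D z K 0 ->
  (forall y, limiting_normal_cone K w y -> (y <= B)%MS) ->
  dir_invariant D z w B.
Proof.
move=> polyK cK DK NB; have [L [polyL cL KL]] := polyset_germ w polyK.
(* As [L] is a cone, [y] is a regular normal of [K] at [w + t *: v] for every small [t > 0], and
   these points tend to [w]. *)
have NL v y : regular_normal_cone L v y -> limiting_normal_cone K w y.
  move=> Nv; apply/limiting_normal_coneP; split.
    have [e e0 /(_ 0)] := KL; rewrite normr0 !addr0 => /(_ e0)[_]; apply.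
    by have [Lv _] := Nv; exact: conic0 (polyset_closed polyL) cL Lv.
  move=> e e0; have [d d0 Hd] := same_germ_conic cL KL (`|v| + 1).
  have v1 : 0 < `|v| + 1 by rewrite ltr_wpDl.
  pose t := Num.min (d / 2) (e / (`|v| + 1)).
  have t0 : 0 < t by rewrite lt_min !divr_gt0.
  have td : t <= d / 2 by rewrite ge_min lexx.
  have te : t * (`|v| + 1) <= e by rewrite -ler_pdivlMr// ge_min lexx orbT.
  have [||_ NE] := Hd t v; [by apply/andP; split; lra|by rewrite ltrDl|].
  exists (w + t *: v), y; rewrite NE subrr normr0; split=> //.
  by rewrite addrAC subrr add0r normrZ gtr0_norm// (lt_le_trans _ te)// ltr_pM2l// ltrDl.
have [e1 e10 DKE] := same_germ_conic cK DK (`|w| + 1).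
have [e2 e20 KLE] := KL.
exists (Num.min (Num.min e1 e2) 1); first by rewrite !lt_min e10 e20 ltr01.
move=> t w1 w2; rewrite !lt_min => /andP[t0 /andP[/andP[te1 _] _]].
move=> /andP[/andP[_ w1e] w11] /andP[/andP[_ w2e] w21] w12.
have [||DK1 _] := DKE t w1; [by rewrite t0|exact: lt_norm_near|].
have [||DK2 _] := DKE t w2; [by rewrite t0|exact: lt_norm_near|].
move=> /DK1 K1; apply/DK2.
have := KLE _ w1e; have := KLE _ w2e.
rewrite ![w + _]addrC !subrK !add0r => -[_ K2] [/(_ K1) L1 _]; apply: K2.
have -> : w2 - w = (w1 - w) + (w2 - w1) by rewrite [RHS]addrC addrA subrK.
apply: polyset_orthogonal_invariant => // v y /NL/NB/submxP[c ->].
rewrite innerE -mulmxA (_ : B *m _ = 0) ?mulmx0 ?mxE//.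
by apply: trmx_inj; rewrite trmx_mul trmxK mulmxBl w12 subrr trmx0.
Qed.

(** The hypotheses make [c |-> c *m B *m J^T] injective; transposing a right inverse gives [Q], a
    linear section of [v |-> v *m (J *m B^T)]. *)
Lemma row_free_right_inverse r n d (B : 'M[R]_(r, d)) (J : 'M[R]_(n, d)) :
  row_free B -> (forall c : 'rV_r, c *m B *m J^T = 0 -> c *m B = 0) ->
  exists Q : 'M[R]_(r, n), Q *m (J *m B^T) = 1%:M.
Proof.
move=> freeB H; have /row_freeP[Q HQ] : row_free (B *m J^T).
  apply: inj_row_free => v; rewrite mulmxA => /H vB.
  by apply: (row_free_inj freeB); rewrite vB mul0mx.
by exists Q^T; apply: trmx_inj; rewrite !trmx_mul !trmxK trmx1.
Qed.

End Invariance.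

(** * Strict differentiability and solvability of perturbed equations *)

Section StrictDifferentiability.
Variable R : realType.

Definition strict_diff n d (G : 'rV[R]_n -> 'rV[R]_d) x (J : 'M[R]_(n, d)) :=
  forall e : R, 0 < e -> exists2 r, 0 < r & forall x1 x2,
    `|x1 - x| < r -> `|x2 - x| < r -> `|G x1 - G x2 - (x1 - x2) *m J| <= e * `|x1 - x2|.

Lemma is_derive_segment n d (G : 'rV[R]_n -> 'rV[R]_d) (y h : 'rV[R]_n) i (s : R) :
  differentiable G (y + s *: h) ->
  is_derive s 1 (fun s : R => G (y + s *: h) ord0 i) ((h *m 'J G (y + s *: h)) ord0 i).
Proof.
move=> dG; have /cvg_ex[l Gl] := @diff_derivable _ _ _ _ _ h dG.
have lE : l = h *m 'J G (y + s *: h) by rewrite -deriveEjacobian//; apply/esym/cvg_lim.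
rewrite -{}lE; set q := fun t : R => _ in Gl.
have ql : (fun t => q t ord0 i) @ 0^' --> l ord0 i.
  apply: (@cvg_comp _ _ _ q (fun M : 'rV_d => M ord0 i) _ _ _ Gl).
  exact: coord_continuous.
have qE : (fun t : R => q t ord0 i) = (fun t : R => t^-1 *:
    (((fun s : R => G (y + s *: h) ord0 i) \o shift s) (t *: 1)
     - G (y + s *: h) ord0 i)).
  apply/funext => t; rewrite /q /= !mxE; congr (_ * (G _ _ _ - _)).
  by rewrite [t *: 1]mulr1 scalerDl addrCA.
rewrite qE in ql; split; first by apply/cvg_ex; exists (l ord0 i).
exact: cvg_lim ql.
Qed.

(** The mean value theorem is applied to each coordinate separately, as the intermediate point
    depends on [i]. *)
Lemma mean_value_segment n d (G : 'rV[R]_n -> 'rV[R]_d) (x y : 'rV[R]_n) i :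
  (forall z, differentiable G z) ->
  exists2 s : R, 0 <= s <= 1 & G x ord0 i - G y ord0 i =
    ((x - y) *m 'J G (y + s *: (x - y))) ord0 i.
Proof.
move=> dG; have D s := is_derive_segment i (dG (y + s *: (x - y))).
have [||s s01] := @MVT_segment R _ _ 0 1 _ (fun s _ => D s).
- exact: ler01.
- apply: continuous_subspaceT => s; apply: differentiable_continuous.
  by apply/derivable1_diffP; have [] := D s.
rewrite subr0 mulr1 scale1r scale0r addr0 [y + (x - y)]addrC subrK => ->.
by exists s => //; rewrite in_itv in s01.
Qed.

(** Each coordinate of the remainder is one of [(x1 - x2) *m (J' - J)], where [J'] is the Jacobian
    at a point of the segment, close to [J] by continuity. *)
Lemma C1_strict_diff n d (G : 'rV[R]_n -> 'rV[R]_d) x :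
  continuously_differentiable G -> strict_diff G x ('J G x).
Proof.
move=> [dG cJ] e e0; have n1 : 0 < n%:R + 1 :> R by rewrite ltr_wpDl.
have /cvgrPdist_lt/(_ (e / (n%:R + 1)) (divr_gt0 e0 n1))/near_normP[r r0 Hr] := cJ x.
exists r => // x1 x2 x1r x2r; apply: mx_norm_le => [|i j].
  by rewrite mulr_ge0// ltW.
rewrite (ord1 i).
have [s /andP[s0 s1] E] := mean_value_segment x1 x2 j dG.
have segr : `|x2 + s *: (x1 - x2) - x| < r.
  have -> : x2 + s *: (x1 - x2) - x = s *: (x1 - x) + (1 - s) *: (x2 - x).
    by apply/rowP => k; rewrite !mxE; ring.
  rewrite (le_lt_trans (ler_normD _ _))// !normrZ (ger0_norm s0) ger0_norm ?subr_ge0//.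
  have : s * `|x1 - x| + (1 - s) * `|x2 - x| <=
      Num.max `|x1 - x| `|x2 - x|.
    set m := Num.max _ _; have -> : m = s * m + (1 - s) * m by ring.
    by rewrite lerD// ler_wpM2l ?subr_ge0// le_max lexx ?orbT.
  by move=> /le_lt_trans; apply; rewrite gt_max x1r.
have := Hr _ segr; set J' := 'J G _ in E *; set J := 'J G x => JJ'.
have -> : (G x1 - G x2 - (x1 - x2) *m J) ord0 j = ((x1 - x2) *m (J' - J)) ord0 j.
  have subE (a b : 'rV[R]_d) : (a - b) ord0 j = a ord0 j - b ord0 j by rewrite !mxE.
  by rewrite mulmxBr !subE E.
rewrite (le_trans (le_mx_norm _ _ _))// (le_trans (norm_mulmx _ _))//.
rewrite mulrAC ler_wpM2r// distrC.
have : (n%:R + 1) * `|J - J'| <= e by rewrite mulrC -ler_pdivlMr// ltW.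
by apply: le_trans; rewrite ler_wpM2r// lerDl.
Qed.

Lemma linear_strict_diff n d (J : 'M[R]_(n, d)) x : strict_diff (mulmx^~ J) x J.
Proof.
move=> e e0; exists 1 => // x1 x2 _ _.
by rewrite mulmxBl subrr normr0 mulr_ge0// ltW.
Qed.

(** Metric regularity of [G _ *m B^T] near [x], with a rate [k] uniform in the base point [x1]. *)
Definition solvable n d m (G : 'rV[R]_n -> 'rV[R]_d) (B : 'M[R]_(m, d)) x (r k : R) :=
  forall x1 eta, `|x1 - x| < r -> `|eta| < r ->
    exists2 x2, `|x2 - x1| <= k * `|eta| & G x2 *m B^T = G x1 *m B^T + eta.

(* Writing [x' = x + zeta *m Q], the equation becomes a fixed point problem for
   [zeta], contracting because [G x *m B^T - x *m (J *m B^T)] is Lipschitz with a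
   small constant. *)
Lemma strict_diff_solvable n d m (G : 'rV[R]_n -> 'rV[R]_d) (B : 'M[R]_(m, d)) x J
    (Q : 'M[R]_(m, n)) :
  strict_diff G x J -> Q *m (J *m B^T) = 1%:M ->
  exists r k, [/\ 0 < r, 0 < k & solvable G B x r k].
Proof.
move=> GJ QJB; pose a := d%:R * `|B^T| * (m%:R * `|Q|).
have a0 : 0 <= a by rewrite !mulr_ge0.
(* Multiplied by [a] this tolerance is at most [1 / 2], which bounds the Lipschitz constant of [h]
   in [zeta]. *)
have [|r0 r00 Hr0] := GJ (1 / (2 * (a + 1))).
  by rewrite divr_gt0// mulr_gt0// ltr_wpDl.
(* The fixed point satisfies [|zeta| <= 2 * |eta|], whence the factor [2]; the [+ 1] gives
   [k > 0]. *)
pose k := m%:R * `|Q| * 2 + 1.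
have k0 : 0 < k by rewrite ltr_wpDl// !mulr_ge0.
exists (Num.min (r0 / 2) (r0 / (2 * k))), k; split=> //.
  by rewrite lt_min !divr_gt0// mulr_gt0.
move=> x1 eta; rewrite !lt_min => /andP[x1r _] /andP[_].
rewrite ltr_pdivlMr ?mulr_gt0// => etar.
pose h x := G x *m B^T - x *m (J *m B^T).
have zk zeta : `|zeta| <= 2 * `|eta| -> `|zeta *m Q| <= k * `|eta|.
  move=> zle; rewrite (le_trans (norm_mulmx _ _))//.
  have := normr_ge0 eta; have : 0 <= m%:R * `|Q| by rewrite mulr_ge0.
  by rewrite /k mulrAC; move: (m%:R * `|Q|) => c c0 eta0; nra.
have inr zeta : `|zeta| <= 2 * `|eta| -> `|x1 + zeta *m Q - x| < r0.
  move=> /zk zle; rewrite addrAC (le_lt_trans (ler_normD _ _))//.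
  by lra.
have hlip zeta zeta' : `|zeta| <= 2 * `|eta| -> `|zeta'| <= 2 * `|eta| ->
    `|h (x1 + zeta *m Q) - h (x1 + zeta' *m Q)| <= 1 / 2 * `|zeta - zeta'|.
  move=> /inr z /inr z'; have := Hr0 _ _ z z'.
  have -> : x1 + zeta *m Q - (x1 + zeta' *m Q) = (zeta - zeta') *m Q.
    by rewrite opprD addrACA subrr add0r mulmxBl.
  have -> : h (x1 + zeta *m Q) - h (x1 + zeta' *m Q) =
    (G (x1 + zeta *m Q) - G (x1 + zeta' *m Q) - (zeta - zeta') *m Q *m J) *m B^T.
    rewrite /h !mulmxBl !mulmxDl !mulmxA; apply/rowP => i; rewrite !mxE; ring.
  move: (G _ - G _ - _) => g gle; rewrite (le_trans (norm_mulmx _ _))// mulrAC.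
  have : `|(zeta - zeta') *m Q| <= m%:R * `|Q| * `|zeta - zeta'|.
    by rewrite (le_trans (norm_mulmx _ _))// mulrAC.
  move: gle; rewrite mul1r -ler_pdivrMl ?invr_gt0 ?mulr_gt0 ?ltr_wpDl// invrK.
  move=> gle zle; have := le_trans gle zle.
  have b0 : 0 <= d%:R * `|B^T| by rewrite mulr_ge0.
  move=> /(ler_wpM2l b0); rewrite [leRHS]mulrA -/a.
  rewrite mulrCA => H; rewrite -(ler_pM2l (x := 2 * (a + 1))) ?mulr_gt0 ?ltr_wpDl//.
  by rewrite (le_trans H)//; have := normr_ge0 (zeta - zeta'); lra.
(* Since [QJB] turns [zeta *m Q *m (J *m B^T)] into [zeta], a fixed point of [f] solves the
   equation; contraction by [1 / 2] and [f 0 = eta] keep the ball of radius [2 * |eta|] stable. *)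
pose f zeta := eta - (h (x1 + zeta *m Q) - h x1).
have [||||zeta zle fz] := @contraction_fixpoint R m f (2 * `|eta|) (1 / 2).
- by rewrite mulr_ge0.
- by apply/andP; split; lra.
- move=> zeta zle; rewrite /f (le_trans (ler_normB _ _))//.
  have := hlip zeta 0 zle; rewrite mul0mx addr0 normr0 subr0 mulr_ge0// => /(_ isT).
  by have := normr_ge0 zeta; lra.
- move=> z z' zl z'l; rewrite /f.
  have subE (p q s : 'rV[R]_m) : eta - (p - s) - (eta - (q - s)) = q - p.
    by apply/rowP => i; rewrite !mxE; ring.
  by rewrite subE distrC; exact: hlip.
exists (x1 + zeta *m Q); first by rewrite addrAC subrr add0r zk.
have -> : G (x1 + zeta *m Q) *m B^T = h (x1 + zeta *m Q) + (x1 + zeta *m Q) *m (J *m B^T).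
  by rewrite subrK.
rewrite mulmxDl -[zeta *m Q *m _]mulmxA QJB mulmx1 -{2}fz /f /h.
by apply/rowP => i; rewrite !mxE; ring.
Qed.

End StrictDifferentiability.

(** * First-order estimates and regular normals of preimages *)

Section NormalConePreimage.
Variable R : realType.

Lemma le0_of_small (a C : R) : (forall e, 0 < e < 1 -> a <= C * e) -> a <= 0.
Proof.
move=> H; rewrite leNgt; apply/negP => a0.
have C1 : 0 < `|C| + 1 by rewrite ltr_wpDl.
pose e := Num.min (1 / 2) (a / (2 * (`|C| + 1))).
have e0 : 0 < e by rewrite lt_min !divr_gt0// mulr_gt0.
have e1 : e <= 1 / 2 by rewrite ge_min lexx.
have ea : e * (2 * (`|C| + 1)) <= a by rewrite -ler_pdivlMr ?mulr_gt0// ge_min lexx orbT.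
have : a <= C * e by apply: H; apply/andP; split; lra.
have : C * e <= `|C| * e by rewrite ler_wpM2r ?ler_norm// ltW.
by lra.
Qed.

Lemma small_mul (C e : R) : 0 <= C -> 0 < e -> exists2 r, 0 < r < 1 & C * r <= e.
Proof.
move=> C0 e0; exists (Num.min (1 / 2) (e / (C + 1))).
  rewrite lt_min !divr_gt0 ?ltr_wpDl//=.
  by rewrite gt_min; apply/orP; left; lra.
have : Num.min (1 / 2) (e / (C + 1)) * (C + 1) <= e.
  by rewrite -ler_pdivlMr ?ltr_wpDl// ge_min lexx orbT.
have : 0 <= Num.min (1 / 2) (e / (C + 1)).
  by rewrite le_min !divr_ge0 ?addr_ge0// ltW.
by lra.
Qed.

Lemma regular_normal_of_bound n (S : set 'rV[R]_n) z zs (C : R) : S z ->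
  (forall e, 0 < e < 1 -> exists2 r, 0 < r &
    forall h, `|h| < r -> S (z + h) -> inner zs h <= C * e * `|h|) ->
  regular_normal_cone S z zs.
Proof.
move=> Sz H; apply/regular_normal_coneP; split=> // e e0.
have [s s01 sC] := small_mul (normr_ge0 C) e0.
have [r r0 Hr] := H s s01; exists r => // h hr Szh.
rewrite (le_trans (Hr h hr Szh))// ler_wpM2r// (le_trans _ sC)//.
by rewrite ler_wpM2r ?ler_norm//; case/andP: s01 => /ltW.
Qed.

Lemma strict_diffP n d (G : 'rV[R]_n -> 'rV[R]_d) x J e : strict_diff G x J -> 0 < e ->
  exists2 r, 0 < r & forall h, `|h| < r -> `|G (x + h) - G x - h *m J| <= e * `|h|.
Proof.
move=> GJ e0; have [r r0 H] := GJ e e0; exists r => // h hr.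
have := H (x + h) x; rewrite subrr normr0 addrAC subrr add0r; exact.
Qed.

Lemma strict_diff_lipschitz n d (G : 'rV[R]_n -> 'rV[R]_d) x J : strict_diff G x J ->
  exists2 r, 0 < r & forall x1 x2, `|x1 - x| < r -> `|x2 - x| < r ->
    `|G x1 - G x2| <= (n%:R * `|J| + 1) * `|x1 - x2|.
Proof.
move=> GJ; have [r r0 H] := GJ 1 ltr01; exists r => // x1 x2 x1r x2r.
rewrite -[G x1 - G x2](subrK ((x1 - x2) *m J)) (le_trans (ler_normD _ _))//.
rewrite mulrDl addrC lerD//; last exact: H.
by rewrite (le_trans (norm_mulmx _ _))// mulrAC.
Qed.

(** The witness [w] is the difference quotient of [G] along [v'], which tends to [v *m J]. *)
Lemma strict_diff_direction n d (G : 'rV[R]_n -> 'rV[R]_d) x J v e :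
  strict_diff G x J -> 0 < e ->
  exists2 r, 0 < r & forall t v', 0 < t < r -> `|v' - v| < r ->
    exists2 w, `|w - v *m J| < e & G (x + t *: v') = G x + t *: w.
Proof.
move=> GJ e0; have v1 : 0 < `|v| + 1 by rewrite ltr_wpDl.
have [s /andP[s0 s1] sC] : exists2 s, 0 < s < 1 & (n%:R * `|J| + `|v| + 1) * s <= e / 2.
  by apply: small_mul; rewrite ?addr_ge0 ?mulr_ge0// divr_gt0.
have [r0 r00 Hr0] := strict_diffP GJ s0.
exists (Num.min s (r0 / (`|v| + 1))); first by rewrite lt_min s0 divr_gt0.
move=> t v'; rewrite !lt_min ltr_pdivlMr// => /andP[t0 /andP[ts tr]] /andP[vs _].
have v'1 : `|v'| < `|v| + 1 by apply: lt_norm_near; exact: lt_trans s1.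
exists (t^-1 *: (G (x + t *: v') - G x)); last first.
  by rewrite scalerA divff ?gt_eqF// scale1r [RHS]addrC subrK.
have tv' : `|t *: v'| = t * `|v'| by rewrite normrZ gtr0_norm.
have : `|G (x + t *: v') - G x - t *: v' *m J| <= s * (t * `|v'|).
  rewrite -tv'; apply: Hr0; rewrite tv' (le_lt_trans _ tr)// ler_pM2l//.
  exact: ltW.
rewrite mulrCA -ler_pdivrMl// -[t^-1 in leLHS]gtr0_norm ?invr_gt0// -normrZ.
rewrite scalerBr -scalemxAl scalerA mulVf ?gt_eqF// scale1r => H1.
have H2 : `|(v' - v) *m J| <= n%:R * `|J| * s.
  by rewrite (le_trans (norm_mulmx _ _))// mulrAC ler_wpM2l ?mulr_ge0// ltW.
rewrite -(subrK (v' *m J) (t^-1 *: _)) -addrA -mulmxBl.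
rewrite (le_lt_trans (ler_normD _ _))//.
have : s * `|v'| <= s * (`|v| + 1) by rewrite ler_pM2l// ltW.
by move: H1 H2; move: `|_ - _| `|_ *m _| => a b; lra.
Qed.

(** A converse of [strict_diff_direction] modulo the kernel of [B^T]: directions [w] near [v *m J]
    are lifted to directions [v'] near [v]. *)
Lemma solvable_direction n d m (G : 'rV[R]_n -> 'rV[R]_d) (B : 'M[R]_(m, d)) x J r k v e :
  strict_diff G x J -> 0 < r -> 0 < k -> solvable G B x r k -> 0 < e ->
  exists2 s, 0 < s & forall t w, 0 < t < s -> `|w - v *m J| < s ->
    exists2 v', `|v' - v| < e & G (x + t *: v') *m B^T = (G x + t *: w) *m B^T.
Proof.
move=> GJ r0 k0 sol e0; have v1 : 0 < `|v| + 1 by rewrite ltr_wpDl.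
have b0 : 0 <= d%:R * `|B^T| by rewrite mulr_ge0.
have [c /andP[c0 c1] cC] : exists2 c, 0 < c < 1 &
    (k + 1) * (d%:R * `|B^T| * 2) * c <= Num.min (e / 2) (r / 2).
  by apply: small_mul; rewrite ?mulr_ge0 ?addr_ge0// 1?ltW// lt_min !divr_gt0.
have [r1 r10 Hr1] := strict_diff_direction v GJ c0.
exists (Num.min (Num.min c r1) (r / (`|v| + 1))).
  by rewrite !lt_min c0 r10 divr_gt0.
move=> t w; rewrite !lt_min ltr_pdivlMr// => /andP[t0 /andP[/andP[tc tr1] tr]].
move=> /andP[/andP[wc _] _].
have [||w0 w0c Gw0] := Hr1 t v; rewrite ?t0 ?subrr ?normr0//.
(* The discrepancy between [w] and the direction [w0] reached by [v]. It is of order [t * c], so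
   solving moves the point by that order and the direction by order [c]. *)
pose eta := t *: ((w - w0) *m B^T).
have etale : `|eta| <= t * (d%:R * `|B^T| * 2 * c).
  rewrite normrZ gtr0_norm// ler_pM2l// (le_trans (norm_mulmx _ _))//.
  rewrite mulrAC -[leRHS]mulrA ler_wpM2l//.
  have -> : w - w0 = (w - v *m J) - (w0 - v *m J) by rewrite opprB addrA subrK.
  by rewrite (le_trans (ler_normB _ _))//; lra.
have cr : d%:R * `|B^T| * 2 * c <= r / 2.
  have : (k + 1) * (d%:R * `|B^T| * 2) * c <= r / 2.
    by rewrite (le_trans cC)// ge_min lexx orbT.
  have : 0 <= k * (d%:R * `|B^T| * 2 * c) by rewrite !mulr_ge0// ltW.
  by lra.
have ce : k * (d%:R * `|B^T| * 2 * c) <= e / 2.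
  have : (k + 1) * (d%:R * `|B^T| * 2) * c <= e / 2.
    by rewrite (le_trans cC)// ge_min lexx.
  have : 0 <= d%:R * `|B^T| * 2 * c by rewrite !mulr_ge0// ltW.
  by lra.
have [||x2 x2le Gx2] := sol (x + t *: v) eta.
- rewrite addrAC subrr add0r normrZ gtr0_norm// (le_lt_trans _ tr)// ler_pM2l//.
  by rewrite lerDl.
- rewrite (le_lt_trans etale)//; have : t < 1 by exact: lt_trans c1.
  move: cr; have : 0 <= d%:R * `|B^T| * 2 * c by rewrite !mulr_ge0// ltW.
  by move: (_ * c) => g g0 gr t1; nra.
exists (v + t^-1 *: (x2 - (x + t *: v))).
  rewrite addrAC subrr add0r normrZ gtr0_norm ?invr_gt0// ltr_pdivrMl//.
  rewrite (le_lt_trans x2le)//.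
  have : k * `|eta| <= t * (e / 2).
    rewrite (le_trans (ler_wpM2l (ltW k0) etale))//.
    by rewrite mulrCA ler_pM2l.
  have : 0 < t * e by rewrite mulr_gt0.
  by lra.
have -> : x + t *: (v + t^-1 *: (x2 - (x + t *: v))) = x2.
  by rewrite scalerDr scalerA divff ?gt_eqF// scale1r addrA [_ + (x2 - _)]addrC subrK.
rewrite Gx2 Gw0 /eta scalemxAl -mulmxDl; congr (_ *m _).
by rewrite scalerBr -addrA [t *: w0 + _]addrC subrK.
Qed.

(** [h *m J] differs from [G (x + h) - G x] by [o(|h|)], and that increment is [O(|h|)], so the
    first-order bound for [y] on [D] carries over. *)
Lemma regular_normal_preimage_ge n d (G : 'rV[R]_n -> 'rV[R]_d) (D : set 'rV[R]_d) x J y :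
  strict_diff G x J -> regular_normal_cone D (G x) y ->
  regular_normal_cone [set x | D (G x)] x (y *m J^T).
Proof.
move=> GJ /regular_normal_coneP[Dx Hy].
have [r0 r00 lip] := strict_diff_lipschitz GJ.
set l := n%:R * `|J| + 1 in lip.
have l0 : 0 < l by rewrite ltr_wpDl// mulr_ge0.
apply: (@regular_normal_of_bound _ _ _ _ (l + d%:R * `|y|)) => // e /andP[e0 _].
have [r1 r10 H1] := Hy e e0.
have [r2 r20 H2] := strict_diffP GJ e0.
exists (Num.min (Num.min r0 (r1 / l)) r2); first by rewrite !lt_min r00 divr_gt0.
move=> h; rewrite !lt_min ltr_pdivlMr// => /andP[/andP[hr0 hr1] hr2] Dh.
have Gle : `|G (x + h) - G x| <= l * `|h|.
  by have := lip (x + h) x; rewrite subrr normr0 addrAC subrr add0r; exact.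
have := H1 (G (x + h) - G x); rewrite [G x + _]addrC subrK => /(_ _ Dh) I1.
rewrite inner_adjoint.
have -> : h *m J = (G (x + h) - G x) - (G (x + h) - G x - h *m J).
  by rewrite [RHS]addrC opprB subrK.
have := H2 h hr2; move: (G (x + h) - G x - h *m J) => g gle.
rewrite innerBr.
have : - inner y g <= d%:R * `|y| * (e * `|h|).
  rewrite -innerNr (le_trans (ler_norm _))// (le_trans (inner_norm _ _))//.
  by rewrite normrN ler_wpM2l// mulr_ge0.
have : inner y (G (x + h) - G x) <= e * (l * `|h|).
  rewrite (le_trans (I1 _))//; last by rewrite ler_pM2l.
  by rewrite (le_lt_trans Gle)// mulrC.
lra.
Qed.

(** First [xs] annihilates the kernel of [J *m B^T], hence equals [c *m (J *m B^T)^T]. Then an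
    increment [h] of [G x] within [D] is lifted, modulo the kernel of [B^T], to a point of the
    preimage at distance [O(|h|)], where the bound for [xs] gives one for [c *m B]. *)
Lemma regular_normal_preimage_le n d m (G : 'rV[R]_n -> 'rV[R]_d) (D : set 'rV[R]_d)
    (B : 'M[R]_(m, d)) x J (r k rho : R) xs :
  strict_diff G x J -> 0 < r -> 0 < k -> solvable G B x r k -> 0 < rho ->
  (forall z1 z2, `|z1 - G x| < rho -> `|z2 - G x| < rho ->
    z1 *m B^T = z2 *m B^T -> D z1 -> D z2) ->
  regular_normal_cone [set x | D (G x)] x xs ->
  exists2 c, xs = c *m (J *m B^T)^T & regular_normal_cone D (G x) (c *m B).
Proof.
move=> GJ r0 k0 sol rho0 inv /regular_normal_coneP[/= Dx Hxs].
have [rl rl0 lip] := strict_diff_lipschitz GJ.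
set l := n%:R * `|J| + 1 in lip; have l0 : 0 < l by rewrite ltr_wpDl// mulr_ge0.
have [b b0 multB] : exists2 b, 0 <= b & forall z : 'rV_d, `|z *m B^T| <= b * `|z|.
  exists (d%:R * `|B^T|) => [|z]; first by rewrite mulr_ge0.
  by rewrite (le_trans (norm_mulmx _ _))// mulrAC.
have orth_le v : v *m (J *m B^T) = 0 -> inner xs v <= 0.
  move=> vJB; apply: (@le0_of_small _ (`|v| * (1 + k * b + n%:R * `|xs| * k * b))).
  move=> e /andP[e0 e1].
  have [r1 r10 H1] := Hxs e e0; have [r2 r20 H2] := strict_diffP GJ e0.
  have v1 : 0 < `|v| + 1 by rewrite ltr_wpDl.
  have kb0 : 0 <= k * b by rewrite mulr_ge0// ltW.
  pose g := Num.min (Num.min (Num.min r r1) (Num.min r2 rho)) rl.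
  have g0 : 0 < g by rewrite !lt_min r0 r10 r20 rho0.
  pose f := `|v| * (1 + k * b).
  have f0 : 0 <= f by rewrite mulr_ge0// addr_ge0.
  have [s /andP[s0 _] sg] : exists2 s, 0 < s < 1 & (`|v| + b * `|v| + f + l * f) * s <= g / 2.
    apply: small_mul; last by rewrite divr_gt0.
    by rewrite !addr_ge0// mulr_ge0// ltW.
  have svE : `|s *: v| = s * `|v| by rewrite normrZ gtr0_norm.
  have [sg1 sg2 sg3 sg4] : [/\ s * `|v| < g, b * (s * `|v|) < g, s * f < g & l * (s * f) < g].
    have s0' := ltW s0; have l0' := ltW l0.
    have : 0 <= s * `|v| by rewrite mulr_ge0.
    have : 0 <= b * (s * `|v|) by rewrite !mulr_ge0.
    have sf0 : 0 <= s * f by rewrite mulr_ge0.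
    have : 0 <= l * (s * f) by rewrite mulr_ge0.
    by split; lra.
  have : `|G (x + s *: v) - G x - s *: v *m J| <= e * (s * `|v|).
    by rewrite -svE; apply: H2; rewrite svE (lt_le_trans sg1)// /g !ge_min lexx !orbT.
  move=> Gle.
  (* Solving with this [eta] restores the value [G x *m B^T]; as [v] is in the kernel, [eta] and
     hence the correction are only of order [e * s]. *)
  pose eta := (G x - G (x + s *: v)) *m B^T.
  have etale : `|eta| <= b * (e * (s * `|v|)).
    have -> : eta = - (G (x + s *: v) - G x - s *: v *m J) *m B^T.
      by rewrite opprB [RHS]mulmxBl -mulmxA -scalemxAl vJB scaler0 sub0r -mulNmx opprB.
    by rewrite (le_trans (multB _))// normrN ler_wpM2l.
  have etale' : `|eta| <= b * (s * `|v|).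
    by rewrite (le_trans etale)// ler_wpM2l// ler_piMl ?mulr_ge0// ltW.
  have [||x2 x2le Gx2] := sol (x + s *: v) eta.
  - by rewrite addrAC subrr add0r svE (lt_le_trans sg1)// /g !ge_min lexx.
  - by rewrite (le_lt_trans etale')// (lt_le_trans sg2)// /g !ge_min lexx.
  have x2le1 : `|x2 - (x + s *: v)| <= k * b * e * (s * `|v|).
    by rewrite (le_trans x2le)// -!mulrA ler_pM2l.
  have x2le2 : `|x2 - x| <= s * f.
    have -> : x2 - x = (x2 - (x + s *: v)) + s *: v by rewrite opprD addrA subrK.
    rewrite (le_trans (ler_normD _ _))// svE.
    have : k * `|eta| <= k * (b * (s * `|v|)) by rewrite ler_pM2l.
    by rewrite /f; lra.
  have Gx2le : `|G x2 - G x| < g.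
    rewrite (le_lt_trans (lip _ _ _ _))// ?subrr ?normr0//.
      by rewrite (le_lt_trans x2le2)// (lt_le_trans sg3)// /g !ge_min lexx !orbT.
    by rewrite (le_lt_trans _ sg4)// ler_pM2l.
  have Dx2 : D (G x2).
    apply: (inv (G x)) => //; rewrite ?subrr ?normr0//.
      by rewrite (lt_le_trans Gx2le)// /g !ge_min lexx !orbT.
    by rewrite Gx2 /eta mulmxBl addrC subrK.
  have := H1 (x2 - x); rewrite [x + _]addrC subrK => /(_ _ Dx2) I1.
  have {}I1 : inner xs (x2 - x) <= e * (s * f).
    rewrite (le_trans (I1 _)) ?ler_pM2l//.
    by rewrite (le_lt_trans x2le2)// (lt_le_trans sg3)// /g !ge_min lexx !orbT.
  have I2 : - inner xs (x2 - (x + s *: v)) <= n%:R * `|xs| * (k * b * e * (s * `|v|)).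
    rewrite -innerNr (le_trans (ler_norm _))// (le_trans (inner_norm _ _))//.
    by rewrite normrN ler_wpM2l.
  rewrite -(ler_pM2l s0) -innerZr.
  have -> : s *: v = (x2 - x) - (x2 - (x + s *: v)).
    by rewrite opprB addrC addrA subrK addrAC subrr add0r.
  by rewrite innerBr (le_trans (lerD I1 I2))// /f; lra.
have orth v : v *m (J *m B^T) = 0 -> inner xs v = 0.
  move=> vJB; apply/le_anti; rewrite orth_le//= -oppr_le0 -innerNr orth_le//.
  by rewrite mulNmx vJB oppr0.
(* The transposed columns of the cokernel matrix are in the kernel of [J *m B^T], so [xs] is
   orthogonal to them, which is membership in the row space. *)
have /submxP[c xsE] : (xs <= (J *m B^T)^T)%MS.
  rewrite submxE; apply/eqP/rowP => j; rewrite [RHS]mxE.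
  have <- : inner xs (col j (cokermx (J *m B^T)^T))^T = (xs *m cokermx (J *m B^T)^T) ord0 j.
    by rewrite innerE trmxK colE mulmxA -colE [LHS]mxE.
  apply: orth; apply: trmx_inj.
  by rewrite trmx_mul trmxK colE mulmxA mulmx_coker mul0mx trmx0.
exists c => //.
apply: (@regular_normal_of_bound _ _ _ _ ((1 + m%:R * `|c| * b) * (k * b))) => // e /andP[e0 e1].
have [r1 r10 H1] := Hxs e e0; have [r2 r20 H2] := strict_diffP GJ e0.
have kb0 : 0 <= k * b by rewrite mulr_ge0// ltW.
pose g := Num.min (Num.min (Num.min r r1) (Num.min r2 rho)) rl.
have g0 : 0 < g by rewrite !lt_min r0 r10 r20 rho0.
have [s /andP[s0 s1] sg] : exists2 s, 0 < s < 1 & (1 + b + k * b + l * (k * b)) * s <= g.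
  by apply: small_mul => //; rewrite !addr_ge0// mulr_ge0// ltW.
exists s => // h hs Dh.
have h0 := normr_ge0 h.
have [hg1 hg2 hg3 hg4] : [/\ `|h| < g, b * `|h| < g, k * b * `|h| < g & l * (k * b * `|h|) < g].
  have hs' := ltW hs; have s0' := ltW s0; have l0' := ltW l0.
  have : 0 <= b * s by rewrite mulr_ge0.
  have : 0 <= k * b * s by rewrite mulr_ge0.
  have : 0 <= l * (k * b * s) by rewrite mulr_ge0// mulr_ge0.
  have : b * `|h| <= b * s by rewrite ler_wpM2l.
  have khs : k * b * `|h| <= k * b * s by rewrite ler_wpM2l.
  have : l * (k * b * `|h|) <= l * (k * b * s) by rewrite ler_pM2l.
  by split; lra.
have [||x2 x2le Gx2] := sol x (h *m B^T).
- by rewrite subrr normr0.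
- by rewrite (le_lt_trans (multB _))// (lt_le_trans hg2)// /g !ge_min lexx.
have {}x2le : `|x2 - x| <= k * b * `|h|.
  by rewrite (le_trans x2le)// -mulrA ler_pM2l.
have Gx2le : `|G x2 - G x| < g.
  rewrite (le_lt_trans (lip _ _ _ _))// ?subrr ?normr0//.
    by rewrite (le_lt_trans x2le)// (lt_le_trans hg3)// /g !ge_min lexx !orbT.
  by rewrite (le_lt_trans _ hg4)// ler_pM2l.
have Dx2 : D (G x2).
  apply: (inv (G x + h)) => //.
  - by rewrite addrAC subrr add0r (lt_le_trans hg1)// /g !ge_min lexx !orbT.
  - by rewrite (lt_le_trans Gx2le)// /g !ge_min lexx !orbT.
  - by rewrite Gx2 mulmxDl.
have := H1 (x2 - x); rewrite [x + _]addrC subrK => /(_ _ Dx2) I1.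
have {}I1 : inner xs (x2 - x) <= e * `|x2 - x|.
  by apply: I1; rewrite (le_lt_trans x2le)// (lt_le_trans hg3)// /g !ge_min lexx !orbT.
have := H2 (x2 - x); rewrite [x + _]addrC subrK => I2.
have {}I2 : `|G x2 - G x - (x2 - x) *m J| <= e * `|x2 - x|.
  by apply: I2; rewrite (le_lt_trans x2le)// (lt_le_trans hg3)// /g !ge_min lexx !orbT.
have -> : inner (c *m B) h = inner xs (x2 - x) + inner c ((G x2 - G x - (x2 - x) *m J) *m B^T).
  rewrite -[B in LHS]trmxK inner_adjoint xsE inner_adjoint -innerDr; congr inner.
  by rewrite mulmxA -mulmxDl [_ + (_ - _)]addrC subrK mulmxBl Gx2 addrAC subrr add0r.
have I3 : inner c ((G x2 - G x - (x2 - x) *m J) *m B^T) <= m%:R * `|c| * (b * (e * `|x2 - x|)).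
  rewrite (le_trans (ler_norm _))// (le_trans (inner_norm _ _))// ler_wpM2l ?mulr_ge0//.
  by rewrite (le_trans (multB _))// ler_wpM2l.
rewrite (le_trans (lerD I1 I3))//.
have -> : e * `|x2 - x| + m%:R * `|c| * (b * (e * `|x2 - x|)) =
    (1 + m%:R * `|c| * b) * e * `|x2 - x| by ring.
have -> : (1 + m%:R * `|c| * b) * (k * b) * e * `|h| =
    (1 + m%:R * `|c| * b) * e * (k * b * `|h|) by ring.
by rewrite ler_wpM2l// mulr_ge0 ?addr_ge0 ?mulr_ge0// ltW.
Qed.

End NormalConePreimage.

(** * Directional normals of preimages *)

Section DirectionalPreimage.
Variable R : realType.

(** A point near [z + t *: w1] is [z] plus [t] times a direction near [w1]; dividing by [t] shows
    that radius [t * r] suffices. *)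
Lemma invariant_near n m (D : set 'rV[R]_n) (B : 'M[R]_(m, n)) z w (e t : R) w1 w2 :
  (forall t w1 w2, 0 < t < e -> `|w1 - w| < e -> `|w2 - w| < e ->
    w1 *m B^T = w2 *m B^T -> D (z + t *: w1) -> D (z + t *: w2)) ->
  0 < t < e -> `|w1 - w| < e -> `|w2 - w| < e ->
  exists2 r, 0 < r & forall z1 z2, `|z1 - (z + t *: w1)| < r -> `|z2 - (z + t *: w2)| < r ->
    z1 *m B^T = z2 *m B^T -> D z1 -> D z2.
Proof.
move=> inv te w1e w2e; have /andP[t0 _] := te.
have dirE z1 : z1 = z + t *: (t^-1 *: (z1 - z)).
  by rewrite scalerA divff ?gt_eqF// scale1r addrC subrK.
have dir_close w' z1 (r : R) : `|w' - w| + r <= e -> `|z1 - (z + t *: w')| < t * r ->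
    `|t^-1 *: (z1 - z) - w| < e.
  move=> w'r z1r; apply: lt_le_trans w'r.
  have -> : t^-1 *: (z1 - z) - w = (w' - w) + t^-1 *: (z1 - (z + t *: w')).
    by apply/rowP => i; rewrite !mxE; field; rewrite gt_eqF.
  rewrite (le_lt_trans (ler_normD _ _))// ltrD2l normrZ gtr0_norm ?invr_gt0//.
  by rewrite ltr_pdivrMl.
pose r := Num.min (e - `|w1 - w|) (e - `|w2 - w|).
have r0 : 0 < r by rewrite lt_min !subr_gt0 w1e.
exists (t * r) => [|z1 z2 z1r z2r z12]; first exact: mulr_gt0.
rewrite (dirE z1) (dirE z2); apply: inv => //.
- by apply: dir_close z1r; rewrite addrC -lerBrDr ge_min lexx.
- by apply: dir_close z2r; rewrite addrC -lerBrDr ge_min lexx orbT.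
- by rewrite -!scalemxAl !mulmxBl z12.
Qed.

Lemma regular_normal_invariant n m (D : set 'rV[R]_n) (B : 'M[R]_(m, n)) z1 z2 (r : R) :
  0 < r ->
  (forall z z', `|z - z1| < r -> `|z' - z2| < r -> z *m B^T = z' *m B^T -> D z -> D z') ->
  (forall z z', `|z - z2| < r -> `|z' - z1| < r -> z *m B^T = z' *m B^T -> D z -> D z') ->
  z1 *m B^T = z2 *m B^T ->
  regular_normal_cone D z1 `<=` regular_normal_cone D z2.
Proof.
move=> r0 inv12 inv21 z12; apply: regular_normal_germ; exists r => // h hr.
split; [apply: inv12|apply: inv21];
  by rewrite ?mulmxDl ?z12// addrAC subrr add0r.
Qed.

(** * Abstract derivative [Jf], covering both [G] and its linearisation *)

Section Preimage.
Variables (n d m : nat) (G : 'rV[R]_n -> 'rV[R]_d) (Jf : 'rV[R]_n -> 'M[R]_(n, d)).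
Variables (D : set 'rV[R]_d) (xbar u : 'rV[R]_n) (B : 'M[R]_(m, d)) (Q : 'M[R]_(m, n)).
Let J := Jf xbar.
Hypothesis GJ : forall x, strict_diff G x (Jf x).
Hypothesis Jcont : forall e, 0 < e ->
  exists2 r, 0 < r & forall x, `|x - xbar| < r -> `|Jf x - J| < e.
Hypothesis Dxbar : D (G xbar).
Hypothesis QJB : Q *m (J *m B^T) = 1%:M.
Hypothesis Dinv : dir_invariant D (G xbar) (u *m J) B.

Lemma near_direction (e : R) : 0 < e -> exists2 r, 0 < r & forall t v,
  0 < t < r -> `|v - u| < r -> `|xbar + t *: v - xbar| < e.
Proof.
move=> e0; have u1 : 0 < `|u| + 1 by rewrite ltr_wpDl.
exists (Num.min 1 (e / (`|u| + 1))); first by rewrite lt_min ltr01 divr_gt0.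
move=> t v; rewrite !lt_min ltr_pdivlMr// => /andP[t0 /andP[_ te]] /andP[/lt_norm_near vu _].
rewrite addrAC subrr add0r normrZ gtr0_norm// (lt_trans _ te)//.
by rewrite ltr_pM2l.
Qed.

(** Each approximating direction [w] is lifted to some [v]. The points [G (xbar + t *: v)] and
    [G xbar + t *: w] have the same image under [B^T], so [D] has the same regular normals there;
    continuity of [Jf] gives the limit. *)
Lemma dir_normal_preimage_ge y : dir_normal_cone D (G xbar) (u *m J) y ->
  dir_normal_cone [set x | D (G x)] xbar u (y *m J^T).
Proof.
move=> /dir_normal_coneP[_ Hy]; apply/dir_normal_coneP; split=> // e e0.
have [r [k [r0 k0 sol]]] := strict_diff_solvable (GJ xbar) QJB.
have [ei ei0 inv] := Dinv.
pose C := d%:R * (`|J| + 1 + `|y|).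
have C0 : 0 <= C by rewrite mulr_ge0// !addr_ge0.
have [c /andP[c0 c1] cC] := small_mul C0 (divr_gt0 e0 (ltr0Sn _ 1)).
have [rJ rJ0 HJ] := Jcont c0.
have [rn rn0 Hrn] := near_direction rJ0.
have [rd rd0 Hrd] := strict_diff_direction u (GJ xbar) ei0.
pose f := Num.min (Num.min e rn) rd.
have f0 : 0 < f by rewrite !lt_min e0 rn0.
have [rs rs0 Hrs] := solvable_direction u (GJ xbar) r0 k0 sol f0.
pose g := Num.min (Num.min f c) (Num.min ei rs).
have g0 : 0 < g by rewrite !lt_min e0 rn0 rd0 c0 ei0.
have [t [w [y' [/andP[t0 tg] wg y'g Ny']]]] := Hy g g0.
have [ge gn gd gc] : [/\ g <= e, g <= rn, g <= rd & g <= c].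
  by rewrite /g /f !ge_min !lexx !orbT.
have [gi gs] : g <= ei /\ g <= rs by rewrite /g !ge_min !lexx !orbT.
have [||v vf Gv] := Hrs t w; [by rewrite t0 (lt_le_trans tg)|exact: lt_le_trans gs|].
have [fe fn fd] : [/\ f <= e, f <= rn & f <= rd] by rewrite /f !ge_min !lexx !orbT.
have [||w' w'i Gv'] := Hrd t v; [by rewrite t0 (lt_le_trans tg)|exact: lt_le_trans fd|].
have ti : 0 < t < ei by rewrite t0 (lt_le_trans tg).
have wi : `|w - u *m J| < ei by exact: lt_le_trans gi.
have [r1 r10 inv1] := invariant_near inv ti wi w'i.
have [r2 r20 inv2] := invariant_near inv ti w'i wi.
have zz : (G xbar + t *: w) *m B^T = (G xbar + t *: w') *m B^T by rewrite -Gv' Gv.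
have N' : regular_normal_cone D (G (xbar + t *: v)) y'.
  rewrite Gv'; apply: (@regular_normal_invariant _ _ D B _ _ (Num.min r1 r2)) Ny' => //.
  - by rewrite lt_min r10.
  - by move=> z z'; rewrite !lt_min => /andP[z1 _] /andP[z2 _]; exact: inv1.
  - by move=> z z'; rewrite !lt_min => /andP[_ z1] /andP[_ z2]; exact: inv2.
exists t, v, (y' *m (Jf (xbar + t *: v))^T); split.
- by rewrite t0 (lt_le_trans tg).
- exact: lt_le_trans fe.
- have Jc : `|Jf (xbar + t *: v) - J| < c.
    apply: HJ; apply: Hrn; last exact: lt_le_trans fn.
    by rewrite t0 (lt_le_trans tg).
  have -> : y' *m (Jf (xbar + t *: v))^T - y *m J^T =
      (y' - y) *m (Jf (xbar + t *: v))^T + y *m (Jf (xbar + t *: v) - J)^T.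
    by rewrite linearB/= mulmxBl mulmxBr addrA subrK.
  rewrite (le_lt_trans (ler_normD _ _))//.
  have -> : e = e / 2 + e / 2 by lra.
  have y'c : `|y' - y| <= c by rewrite (le_trans (ltW y'g)).
  have Jle : `|Jf (xbar + t *: v)| <= `|J| + 1.
    rewrite -[Jf (xbar + _)](subrK J) (le_trans (ler_normD _ _))// addrC lerD2l.
    by rewrite ltW// (lt_trans Jc).
  have A1 : `|(y' - y) *m (Jf (xbar + t *: v))^T| <= d%:R * c * (`|J| + 1).
    rewrite (le_trans (norm_mulmx _ _))// norm_trmx ler_pM ?mulr_ge0//.
    by rewrite ler_wpM2l.
  have A2 : `|y *m (Jf (xbar + t *: v) - J)^T| <= d%:R * `|y| * c.
    by rewrite (le_trans (norm_mulmx _ _))// norm_trmx ler_wpM2l ?mulr_ge0// ltW.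
  by move: cC; rewrite /C; lra.
- exact: regular_normal_preimage_ge (GJ _) N'.
Qed.

(** The multiplier [c] of a regular normal [xs'] is close to [xs' *m Q^T], hence to the fixed vector
    [xs *m Q^T]. So multipliers converge without extracting a subsequence. *)
Lemma near_regular_normal xs : exists2 C, 0 <= C & forall e,  0 < e < 1 ->
  exists2 s, 0 < s & forall t v xs', 0 < t < s -> `|v - u| < s -> `|xs' - xs| < s ->
    regular_normal_cone [set x | D (G x)] (xbar + t *: v) xs' ->
  exists w c, [/\ `|w - u *m J| < e, regular_normal_cone D (G xbar + t *: w) (c *m B),
     `|c - xs *m Q^T| <= C * e & `|xs - c *m (J *m B^T)^T| <= C * e].
Proof.
have [r [k [r0 k0 sol]]] := strict_diff_solvable (GJ xbar) QJB.
have [ei ei0 inv] := Dinv.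
have [b b0 Hb] : exists2 b, 0 <= b & forall (c : 'rV_m) x,
    `|c *m ((Jf x - J) *m B^T)^T| <= b * `|c| * `|Jf x - J|.
  exists (m%:R * (d%:R * `|B^T|)) => [|c x]; first by rewrite !mulr_ge0.
  have mc0 : 0 <= m%:R * `|c| by rewrite mulr_ge0.
  rewrite (le_trans (norm_mulmx _ _))// (norm_trmx (_ *m _)).
  by have := ler_wpM2l mc0 (norm_mulmx (Jf x - J) B^T); lra.
have [q q0 Hq] : exists2 q, 0 <= q & forall x : 'rV_n, `|x *m Q^T| <= q * `|x|.
  exists (n%:R * `|Q^T|) => [|x]; first by rewrite mulr_ge0.
  by rewrite (le_trans (norm_mulmx _ _))// mulrAC.
pose c0 := 2 * q * (`|xs| + 1).
have c00 : 0 <= c0 by rewrite !mulr_ge0// addr_ge0.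
exists (q * (b * c0) + q + 1 + b * c0); first by rewrite !(addr_ge0, mulr_ge0).
move=> e /andP[e0 e1].
(* [f <= a] will make the term [q * (b * |c| * f)] at most [|c| / 2]; absorbing it bounds [|c|] by
   [c0]. *)
have [a /andP[a0 a1] ea] : exists2 a, 0 < a < 1 & (q * b * 2) * a <= 1.
  by apply: small_mul => //; rewrite !mulr_ge0.
have [f f0 [fe fa]] : exists2 f, 0 < f & f <= e /\ f <= a.
  by exists (Num.min e a); rewrite ?lt_min ?e0// !ge_min !lexx orbT.
have [rJ rJ0 HJ] := Jcont f0.
have r20 : 0 < r / 2 by rewrite divr_gt0.
have [rn rn0 Hrn] := near_direction rJ0.
have [rn' rn'0 Hrn'] := near_direction r20.
have em0 : 0 < Num.min e ei by rewrite lt_min e0.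
have [rd rd0 Hrd] := strict_diff_direction u (GJ xbar) em0.
pose s := Num.min (Num.min (Num.min rn rn') (Num.min rd f)) ei.
have s0 : 0 < s by rewrite !lt_min rn0 rn'0 rd0 f0 ei0.
have [sn sn' sd sf si] : [/\ s <= rn, s <= rn', s <= rd, s <= f & s <= ei].
  by rewrite /s !ge_min !lexx !orbT.
exists s => // t v xs' /andP[t0 ts] vs xss N.
set x := xbar + t *: v.
have [||w wem Gx] := Hrd t v; [by rewrite t0 (lt_le_trans ts)|exact: lt_le_trans sd|].
have we : `|w - u *m J| < e by rewrite (lt_le_trans wem)// ge_min lexx.
have wi : `|w - u *m J| < ei by rewrite (lt_le_trans wem)// ge_min lexx orbT.
have ti : 0 < t < ei by rewrite t0 (lt_le_trans ts).
have [rho rho0 Hrho] := invariant_near inv ti wi wi.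
have Jx : `|Jf x - J| < f.
  by apply: HJ; apply: Hrn; [rewrite t0 (lt_le_trans ts)|exact: lt_le_trans sn].
have xr : `|x - xbar| < r / 2.
  by apply: Hrn'; [rewrite t0 (lt_le_trans ts)|exact: lt_le_trans sn'].
have solx : solvable G B x (r / 2) k.
  move=> x1 eta x1x etar; apply: sol; last by lra.
  rewrite -(subrK x x1) -addrA (le_lt_trans (ler_normD _ _))//; lra.
have [|c xsE Nc] := @regular_normal_preimage_le _ _ _ _ G D B x (Jf x) (r / 2) k rho xs'
    (GJ x) r20 k0 solx rho0 _ N.
  by rewrite Gx.
have f1 : f < 1 by exact: le_lt_trans a1.
have cE : c - xs' *m Q^T = - (c *m ((Jf x - J) *m B^T)^T *m Q^T).
  rewrite mulmxBl linearB/= mulmxBr mulmxBl -xsE opprB -(mulmxA c).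
  by rewrite -trmx_mul QJB trmx1 mulmx1.
have cQ : `|c - xs' *m Q^T| <= q * (b * `|c| * f).
  rewrite cE normrN (le_trans (Hq _))// ler_wpM2l// (le_trans (Hb _ _))//.
  by rewrite ler_wpM2l ?mulr_ge0// ltW.
have cle : `|c| <= c0.
  have : `|c| <= q * (b * `|c| * f) + q * (`|xs| + 1).
    rewrite -[X in `|X| <= _](subrK (xs' *m Q^T)) (le_trans (ler_normD _ _))// lerD//.
    rewrite (le_trans (Hq _))// ler_wpM2l// ltW// lt_norm_near// (lt_trans xss)//.
    exact: le_lt_trans f1.
  have : q * (b * `|c| * f) <= `|c| / 2.
    have : q * b * 2 * f <= 1 by rewrite (le_trans _ ea)// ler_wpM2l// !mulr_ge0.
    by have := normr_ge0 c; move: (`|c|) => p p0 *; nra.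
  by rewrite /c0; lra.
have bcf : b * `|c| * f <= b * c0 * e.
  by rewrite ler_pM ?mulr_ge0// ?ler_wpM2l// ltW.
have xsf : `|xs' - xs| <= e by rewrite ltW// (lt_le_trans xss)// (le_trans sf).
have e0' := ltW e0.
have bc0 : 0 <= b * c0 by rewrite mulr_ge0.
have P1 : 0 <= q * (b * c0) * e by rewrite !mulr_ge0.
have P2 : 0 <= q * e by rewrite mulr_ge0.
have P3 : 0 <= b * c0 * e by rewrite mulr_ge0.
exists w, c; rewrite -Gx; split=> //.
  rewrite -(subrK (xs' *m Q^T) c) -addrA -mulmxBl (le_trans (ler_normD _ _))//.
  have : q * (b * `|c| * f) <= q * (b * c0 * e) by rewrite ler_wpM2l.
  have : `|(xs' - xs) *m Q^T| <= q * e by rewrite (le_trans (Hq _))// ler_wpM2l.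
  by lra.
have -> : xs - c *m (J *m B^T)^T = - (xs' - xs) + c *m ((Jf x - J) *m B^T)^T.
  by rewrite opprB mulmxBl linearB/= mulmxBr -xsE addrA subrK.
rewrite (le_trans (ler_normD _ _))// normrN.
have : `|c *m ((Jf x - J) *m B^T)^T| <= b * c0 * e.
  by rewrite (le_trans _ bcf)// (le_trans (Hb _ _))// ler_wpM2l ?mulr_ge0// ltW.
by lra.
Qed.

(** For the remaining inclusion, letting [e] tend to [0] in [near_regular_normal] identifies the
    multiplier as [xs *m Q^T], whose product with [B] is a limit of regular normals of [D]. *)
Lemma dir_normal_preimage : dir_normal_cone [set x | D (G x)] xbar u =
  (fun y => y *m J^T) @` dir_normal_cone D (G xbar) (u *m J).
Proof.
apply/seteqP; split=> [xs|_ [y Ny <-]]; last exact: dir_normal_preimage_ge.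
move=> /dir_normal_coneP[_ Hxs].
have [C C0 H] := near_regular_normal xs.
have {}H e : 0 < e < 1 -> exists t w c, [/\ 0 < t < e, `|w - u *m J| < e,
    regular_normal_cone D (G xbar + t *: w) (c *m B),
    `|c - xs *m Q^T| <= C * e & `|xs - c *m (J *m B^T)^T| <= C * e].
  move=> e01; have /andP[e0 _] := e01; have [s s0 Hs] := H e e01.
  have [|t [v [xs' []]]] := Hxs (Num.min s e); first by rewrite lt_min s0.
  rewrite !lt_min => /andP[t0 /andP[ts te]] /andP[vs _] /andP[xss _] N.
  have [|w [c [? ? ? ?]]] := Hs t v xs' _ vs xss N; first by rewrite t0.
  by exists t, w, c; rewrite t0.
have xsE : xs *m Q^T *m (J *m B^T)^T = xs.
  apply/eqP; rewrite eq_sym -subr_eq0 -normr_le0.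
  set a := m%:R * `|(J *m B^T)^T|.
  have a0 : 0 <= a by rewrite mulr_ge0.
  apply: (@le0_of_small _ _ (C + a * C)) => e e01.
  have [t [w [c [_ _ _ c1 c2]]]] := H e e01.
  have -> : xs - xs *m Q^T *m (J *m B^T)^T =
      (xs - c *m (J *m B^T)^T) + (c - xs *m Q^T) *m (J *m B^T)^T.
    by rewrite mulmxBl addrA subrK.
  rewrite (le_trans (ler_normD _ _))// mulrDl lerD// -mulrA.
  by rewrite (le_trans (norm_mulmx _ _))// mulrAC -/a ler_wpM2l.
exists (xs *m Q^T *m B); last by rewrite -[RHS]xsE trmx_mul trmxK mulmxA.
apply/dir_normal_coneP; split=> // e e0.
have [|s s01 sC] := @small_mul _ (m%:R * C * `|B| + 1) e _ e0.
  by rewrite addr_ge0// !mulr_ge0.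
have [t [w [c [/andP[t0 ts] ws Nc c1 _]]]] := H s s01.
have /andP[s0 _] := s01.
have sCB : m%:R * (C * s) * `|B| < e.
  by apply: lt_le_trans sC; lra.
have C's : 0 <= m%:R * C * `|B| * s by rewrite !mulr_ge0// ltW.
exists t, w, (c *m B); split=> //; [by apply/andP; split=> //; lra|by lra|].
rewrite -mulmxBl (le_lt_trans (norm_mulmx _ _))// (le_lt_trans _ sCB)//.
by rewrite ler_wpM2r// ler_wpM2l.
Qed.

End Preimage.
End DirectionalPreimage.

(** * Tangent cones of preimages and locality of limiting normals *)

Section TangentPreimage.
Variable R : realType.

Lemma closed_linear_preimage n d (K : set 'rV[R]_d) (J : 'M[R]_(n, d)) :
  closed K -> closed [set v | K (v *m J)].
Proof.
move=> clK v clv; apply: (closed_near clK) => e e0.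
have l0 : 0 < n%:R * `|J| + 1 by rewrite ltr_wpDl// mulr_ge0.
have [v' [Kv' vv']] : [set v | K (v *m J)] `&` [set v' | `|v' - v| < e / (n%:R * `|J| + 1)] !=set0.
  by apply: clv; apply/near_normP; exists (e / (n%:R * `|J| + 1)); rewrite ?divr_gt0.
exists (v' *m J) => //; rewrite -mulmxBl (le_lt_trans (norm_mulmx _ _))// mulrAC.
move: vv'; rewrite /= ltr_pdivlMr// => vv'; rewrite (le_lt_trans _ vv')// mulrC.
by rewrite ler_wpM2l// lerDl.
Qed.

Lemma limiting_normal_local n (S S' : set 'rV[R]_n) z (r : R) : 0 < r ->
  (forall z', `|z' - z| < r -> (S z' <-> S' z')) ->
  limiting_normal_cone S z `<=` limiting_normal_cone S' z.
Proof.
move=> r0 SS' zs /limiting_normal_coneP[Sz H]; apply/limiting_normal_coneP; split.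
  by apply/SS' => //; rewrite subrr normr0.
move=> e e0; have [|z' [zs' []]] := H (Num.min e r); first by rewrite lt_min e0.
rewrite !lt_min => /andP[z'e z'r] /andP[zse _] N; exists z', zs'; split=> //.
apply: regular_normal_germ N; exists (r - `|z' - z|); first by rewrite subr_gt0.
move=> h hr; apply: SS'; rewrite addrAC (le_lt_trans (ler_normD _ _))//.
by rewrite -ltrBrDl.
Qed.

Lemma tangent_preimage_sub n d (G : 'rV[R]_n -> 'rV[R]_d) (D : set 'rV[R]_d) x J v :
  strict_diff G x J -> tangent_cone [set x | D (G x)] x v ->
  tangent_cone D (G x) (v *m J).
Proof.
move=> GJ /tangent_coneP[Dx H]; apply/tangent_coneP; split=> // e e0.
have [r r0 Hr] := strict_diff_direction v GJ e0.
have [|t [v' []]] := H (Num.min r e); first by rewrite lt_min r0.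
rewrite !lt_min => /andP[t0 /andP[tr te]] /andP[vr _] Dv'.
have [||w we Gw] := Hr t v'; rewrite ?t0//.
by exists t, w; rewrite -Gw t0.
Qed.

(** Small steps along [v *m J] stay in [D] since [K] is its germ. Lifting them modulo the kernel of
    [B^T] gives directions [v'] near [v], and [dir_invariant], available near [u *m J], puts the
    image of the lifted point in [D]. *)
Lemma tangent_preimage_near n d m (G : 'rV[R]_n -> 'rV[R]_d) (D K : set 'rV[R]_d) x J u
    (B : 'M[R]_(m, d)) (Q : 'M[R]_(m, n)) :
  strict_diff G x J -> Q *m (J *m B^T) = 1%:M -> dir_invariant D (G x) (u *m J) B ->
  D (G x) -> conic K -> same_germ D (G x) K 0 ->
  exists2 r, 0 < r & forall v, `|v - u| < r -> K (v *m J) ->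
    tangent_cone [set x | D (G x)] x v.
Proof.
move=> GJ QJB [ei ei0 inv] Dx cK DK.
have [r [k [r0 k0 sol]]] := strict_diff_solvable GJ QJB.
have l0 : 0 < n%:R * `|J| + 1 by rewrite ltr_wpDl// mulr_ge0.
have ei20 : 0 < ei / 2 by rewrite divr_gt0.
(* Half of [ei] bounds the distance from [v *m J] to [u *m J], the other half that from [w] to
   [v *m J]. *)
exists (ei / 2 / (n%:R * `|J| + 1)) => [|v]; first by rewrite divr_gt0.
rewrite ltr_pdivlMr// => vu KvJ.
have vuJ : `|v *m J - u *m J| < ei / 2.
  rewrite -mulmxBl (le_lt_trans (norm_mulmx _ _))// mulrAC (le_lt_trans _ vu)// mulrC.
  by rewrite ler_wpM2l// lerDl.
apply/tangent_coneP; split=> // e e0.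
have [rd rd0 Hrd] := strict_diff_direction v GJ ei20.
have erd0 : 0 < Num.min e rd by rewrite lt_min e0.
have [rs rs0 Hrs] := solvable_direction v GJ r0 k0 sol erd0.
have [d0 d00 Hd] := same_germ_conic cK DK (`|v *m J| + 1).
have [t t0 [te tei trd [trs td]]] : exists2 t, 0 < t &
    [/\ t < e, t < ei, t < rd & t < rs /\ t < d0].
  pose g := Num.min (Num.min e ei) (Num.min (Num.min rd rs) d0).
  have g0 : 0 < g by rewrite !lt_min e0 ei0 rd0 rs0.
  have : g / 2 < g by lra.
  rewrite {2}/g !lt_min => /andP[/andP[? ?] /andP[/andP[? ?] ?]].
  by exists (g / 2); first by rewrite divr_gt0.
have [||v' v'm Gv'] := Hrs t (v *m J); rewrite ?t0 ?subrr ?normr0//.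
move: v'm; rewrite lt_min => /andP[v'e v'rd].
have [||w wei Gw] := Hrd t v'; rewrite ?t0//.
have [||[_ /(_ KvJ) DvJ] _] := Hd t (v *m J); rewrite ?t0 ?ltrDl//.
exists t, v'; rewrite t0; split=> //=.
rewrite Gw; apply: (inv t (v *m J)) => //; rewrite ?t0//.
- by lra.
- have -> : w - u *m J = (w - v *m J) + (v *m J - u *m J) by rewrite addrA subrK.
  by rewrite (le_lt_trans (ler_normD _ _))//; lra.
- have : (t *: w) *m B^T = (t *: (v *m J)) *m B^T.
    by apply: (addrI (G x *m B^T)); rewrite -!mulmxDl -Gv' Gw.
  by rewrite -!scalemxAl => /(scalerI (lt0r_neq0 t0)).
Qed.

End TangentPreimage.

(** * The chain of equalities between normal cones *)

Theorem theorem4p1 (R : realType) (n d : nat)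
    (G : 'rV[R]_n -> 'rV[R]_d) (D : set 'rV[R]_d) (Gamma : set 'rV[R]_n)
    (xbar u : 'rV[R]_n)
    (G_C1 : continuously_differentiable G)
    (D_poly : polyhedral D)
    (Gamma_def : Gamma = [set x | D (G x)])
    (xbar_Gamma : Gamma xbar)
    (nondegenerate : forall y : 'rV[R]_d,
       jacT_mul G xbar y = 0 ->
       linear_span (dir_normal_cone D (G xbar) (jac_mul G xbar u)) y ->
       y = 0) :
  [/\ dir_normal_cone Gamma xbar u =
        jacT_mul G xbar @` dir_normal_cone D (G xbar) (jac_mul G xbar u),
      jacT_mul G xbar @` dir_normal_cone D (G xbar) (jac_mul G xbar u) =
        jacT_mul G xbar @`
          limiting_normal_cone (tangent_cone D (G xbar)) (jac_mul G xbar u)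
    & jacT_mul G xbar @`
          limiting_normal_cone (tangent_cone D (G xbar)) (jac_mul G xbar u) =
        limiting_normal_cone (tangent_cone Gamma xbar) u].
Proof.
subst Gamma; have Dz : D (G xbar) := xbar_Gamma.
set J := 'J G xbar; set w := jac_mul G xbar u.
have [K [polyK cK DK]] := polyset_germ (G xbar) (polyhedral_polyset D_poly).
have clK := polyset_closed polyK.
have K0 : K 0 by have [r r0 /(_ 0)] := DK; rewrite normr0 !addr0 => /(_ r0)[]; auto.
have KK : same_germ K 0 K 0 by exact: same_germ_refl.
have NE := dir_normal_germ w clK cK DK Dz.
have TE := tangent_cone_germ clK cK DK Dz.
have [m [B [freeB spanB NB]]] := linear_span_basis (dir_normal_cone D (G xbar) w).
have [Q QJB] : exists Q : 'M[R]_(m, n), Q *m (J *m B^T) = 1%:M.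
  by apply: row_free_right_inverse => // c cBJ; apply: nondegenerate.
have KB y : limiting_normal_cone K w y -> (y <= B)%MS by rewrite -NE; exact: NB.
have invD := polyset_dir_invariant polyK cK DK KB.
have invK := polyset_dir_invariant polyK cK KK KB.
have GJ x : strict_diff G x ('J G x) by exact: C1_strict_diff.
have Jcont e : 0 < e -> exists2 r, 0 < r & forall x, `|x - xbar| < r -> `|'J G x - J| < e.
  move=> e0; have [_ /(_ xbar)/cvgrPdist_lt/(_ e e0)/near_normP[r r0 Hr]] := G_C1.
  by exists r; [exact: r0|move=> x xr; rewrite distrC; exact: Hr].
(* With [TE] and [NE] both middle sets become the same image of the directional normal cone of [D],
   which settles the second equality. *)
rewrite TE -NE; split=> //.
  exact: dir_normal_preimage GJ Jcont Dz QJB invD.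
(* [Gamma'] linearises the constraint; near [u] it coincides with the tangent cone, which is all
   that limiting normals at [u] see. *)
pose Gamma' := [set v | K (v *m J)].
have cGamma' : conic Gamma' by move=> t v t0 Kv; rewrite /Gamma'/= -scalemxAl; exact: cK.
have Gamma'0 : Gamma' 0 by rewrite /Gamma'/= mul0mx.
have -> : limiting_normal_cone (tangent_cone [set x | D (G x)] xbar) u =
    limiting_normal_cone Gamma' u.
  have [r r0 Hr] := tangent_preimage_near (GJ xbar) QJB invD Dz cK DK.
  have TGamma v : `|v - u| < r -> tangent_cone [set x | D (G x)] xbar v <-> Gamma' v.
    move=> vu; split; last exact: Hr.
    by move=> /(tangent_preimage_sub (GJ xbar)); rewrite TE.
  apply/seteqP; split; apply: (limiting_normal_local r0) => // v /TGamma.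
  by move=> H; split=> /H.
(* Limiting normals of a closed cone at a point are its directional normals at [0] in that
   direction, so the first equality, applied to the linear map and [K] at base point [0], gives the
   last one. *)
rewrite -(dir_normal_germ u (closed_linear_preimage clK) cGamma' (@same_germ_refl _ _ _ _))//.
rewrite NE -(dir_normal_germ w clK cK KK K0).
have := @dir_normal_preimage R n d m (mulmx^~ J) (fun=> J) K 0 u B Q
  (fun=> linear_strict_diff J _); rewrite mul0mx => <- //.
by move=> e e0; exists 1 => // x _; rewrite subrr normr0.
Qed.
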